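(* Let $g_1,\dots,g_N$ be unit vectors in $\mathbb{R}^3$, any three of which are linearly independent, and let $\gamma_1,\dots,\gamma_N\in\mathbb{R}$ be such that the $N$-grid they define is regular. Then the grid tiling associated with this grid has a growth form, and this growth form is the polyhedron whose vertices are the points $$\pm\frac{\upsilon_{ij}}{\Delta_{ij}},\qquad 1\le i<j\le N,$$ (i.e. the boundary of the convex hull of these points), where for pairwise distinct $i,j,k$: $h_{ij}=g_i\times g_j$, $\delta_{ijk}=\dfrac{|h_{ij}|}{|(h_{ij},g_k)|}$, $D_{ijk}=\det(g_i,g_j,g_k)$ (the determinant of the $3\times 3$ matrix with rows $g_i,g_j,g_k$), $\epsilon_{ijk}=1$ if $D_{ijk}>0$ and $\epsilon_{ijk}=-1$ if $D_{ijk}<0$, and $$\Delta_{ij}=\sum_{k\neq i,j}\frac{1}{\delta_{ijk}},\qquad \upsilon_{ij}=\sum_{k\neq i,j}\frac{\epsilon_{ijk}\,g_k}{\delta_{ijk}}.$$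
   Context: Grid construction (in $\mathbb{R}^d$, here $d=3$): given unit vectors $g_1,\dots,g_N$ and reals $\gamma_1,\dots,\gamma_N$, the $N$-grid is the union of the $N$ families of equidistant parallel planes $\{x\in\mathbb{R}^d:(x,g_i)-\gamma_i\in\mathbb{Z}\}$, $1\le i\le N$, where $(\cdot,\cdot)$ is the standard scalar product. The grid is regular if no point lies on more than $d$ of these planes. The grid decomposes $\mathbb{R}^d$ into cells (closures of connected components of the complement). Define $K_i(x)=\min\{n\in\mathbb{Z}: n\ge (x,g_i)-\gamma_i\}$ and $K(x)=\sum_{i=1}^N K_i(x)g_i$; $K$ is constant on the interior of each cell, mapping cells to a discrete set $\Lambda\subset\mathbb{R}^d$. The grid tiling is the tiling with vertex set $\Lambda$ in which two points of $\Lambda$ are joined by an edge iff the corresponding cells share a facet, and whose tiles are, for each intersection point of $d$ grid planes, the parallelepiped whose vertices are the $K$-images of the $2^d$ cells containing that point. Growth form: two tiles of a tiling of $\mathbb{R}^d$ are neighbours if their intersection has positive $(d-1)$-dimensional volume. A chain is a finite sequence of tiles with consecutive tiles neighbours; its length is the number of tiles minus one; the distance between two tiles is the minimal length of a chain joining them. Given a finite nonempty set $P_0$ of tiles, the $n$-th coordination shell $P_n$ is the set of tiles at distance exactly $n$ from $P_0$. A closed $(d-1)$-dimensional surface $F\subset\mathbb{R}^d$ is a growth form of the tiling if there exist a point $x$ and a constant $C$ such that for all $n$ the shell $P_n$ lies in the $C$-neighbourhood of $x+nF$ (this does not depend on $P_0$). *)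

(* Defs.v *)
From HB Require Import structures.
From mathcomp Require Import all_boot all_order all_algebra.
From mathcomp Require Import classical_sets cardinality reals.
Set Implicit Arguments. Unset Strict Implicit. Unset Printing Implicit Defensive.
Import Order.TTheory GRing.Theory Num.Theory.
Local Open Scope classical_set_scope.
Local Open Scope ring_scope.

Section Grid.
Variable R : realType.
Local Notation V := 'rV[R]_3.

Definition dotp (u v : V) : R := \sum_(a < 3) u 0 a * v 0 a.
Definition vnorm (u : V) : R := Num.sqrt (dotp u u).
Definition crossp (u v : V) : V :=
  \row_(a < 3) (u 0 (inord (a.+1 %% 3)) * v 0 (inord (a.+2 %% 3))
              - u 0 (inord (a.+2 %% 3)) * v 0 (inord (a.+1 %% 3))).

Definition rows3 (u v w : V) : 'M[R]_3 :=
  \matrix_(a < 3, b < 3)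
    (if val a == 0%N then u 0 b else if val a == 1%N then v 0 b else w 0 b).

Definition is_int (x : R) : Prop := exists z : int, x = z%:~R.

Definition conv (A : set V) : set V :=
  [set y | exists (n : nat) (p : 'I_n -> V) (l : 'I_n -> R),
      (forall a, A (p a)) /\ (forall a, 0 <= l a) /\
      \sum_(a < n) l a = 1 /\ y = \sum_(a < n) l a *: p a].

Definition bdry (A : set V) : set V :=
  [set y | forall r : R, 0 < r ->
      (exists z, A z /\ vnorm (z - y) < r) /\
      (exists z, ~ A z /\ vnorm (z - y) < r)].

Definition nbhdC (C : R) (S : set V) : set V :=
  [set y | exists z, S z /\ vnorm (y - z) <= C].

Variables (N : nat) (g : 'I_N -> V) (gamma : 'I_N -> R).

Definition on_plane (i : 'I_N) (x : V) : Prop := is_int (dotp x (g i) - gamma i).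

Definition regular_grid : Prop :=
  forall (x : V) (S : {set 'I_N}),
    (forall i, i \in S -> on_plane i x) -> (#|S| <= 3)%N.

Definition Ki (i : 'I_N) (x : V) : int := Num.ceil (dotp x (g i) - gamma i).
Definition Kmap (x : V) : V := \sum_(i < N) (Ki i x)%:~R *: g i.

Definition offgrid (x : V) : Prop := forall i, ~ on_plane i x.

(* K-images of the cells containing x: the values of K on the components of
   the complement of the grid whose closure contains x *)
Definition cellK (x : V) : set V :=
  [set v | forall r : R, 0 < r ->
     exists y, vnorm (y - x) < r /\ offgrid y /\ Kmap y = v].

Definition ipoint (x : V) : Prop :=
  exists i j k : 'I_N, [/\ i != j, i != k, j != k &
     [/\ on_plane i x, on_plane j x & on_plane k x]].

Definition tile (x : V) : set V := conv (cellK x).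

Definition is_tile (t : set V) : Prop := exists x, ipoint x /\ t = tile x.

(* neighbours: the intersection has positive 2-dimensional volume; for the
   convex intersection of two tiles this means it contains 3 non-collinear points *)
Definition neighbours (t1 t2 : set V) : Prop :=
  t1 <> t2 /\
  exists a b c, (t1 `&` t2) a /\ (t1 `&` t2) b /\ (t1 `&` t2) c /\
                crossp (b - a) (c - a) != 0.

Definition chain_to (P0 : set (set V)) (n : nat) (t : set V) : Prop :=
  exists s : nat -> set V,
    [/\ P0 (s 0%N), s n = t,
        (forall m, (m <= n)%N -> is_tile (s m)) &
        (forall m, (m < n)%N -> neighbours (s m) (s m.+1))].

Definition shell (P0 : set (set V)) (n : nat) : set (set V) :=
  [set t | is_tile t /\ chain_to P0 n t /\
           forall m, (m < n)%N -> ~ chain_to P0 m t].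

Definition growth_form (F : set V) : Prop :=
  forall P0 : set (set V), finite_set P0 -> P0 !=set0 -> P0 `<=` is_tile ->
  exists (x : V) (C : R), forall (n : nat) (t : set V), shell P0 n t ->
     t `<=` nbhdC C [set x + n%:R *: z | z in F].

Definition hvec (i j : 'I_N) : V := crossp (g i) (g j).
Definition delta (i j k : 'I_N) : R :=
  vnorm (hvec i j) / `|dotp (hvec i j) (g k)|.
Definition Ddet (i j k : 'I_N) : R := \det (rows3 (g i) (g j) (g k)).
Definition eps (i j k : 'I_N) : R := if 0 < Ddet i j k then 1 else -1.
Definition Delta (i j : 'I_N) : R :=
  \sum_(k < N | (k != i) && (k != j)) (delta i j k)^-1.
Definition upsilon (i j : 'I_N) : V :=
  \sum_(k < N | (k != i) && (k != j)) (eps i j k / delta i j k) *: g k.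

Definition growth_vertices : set V :=
  [set v | exists i j : 'I_N, (val i < val j)%N /\
     (v = (Delta i j)^-1 *: upsilon i j \/ v = - ((Delta i j)^-1 *: upsilon i j))].

Definition growth_polyhedron : set V := bdry (conv growth_vertices).

End Grid.

(* Main.v *)
(** Let [nu u = \sum_m |(u, g_m)|] and [M u = \sum_m (u, g_m) g_m]. Every point of
    the tile of a grid vertex [x] is [\sum_m c_m g_m], where [c_m] lies between
    [ceil t] and [floor t + 1] for [t = (x, g_m) - gamma_m]; this interval depends
    monotonically on [t], so a point common to the tiles of [x] and [y] forces
    [c_m] to be the same wherever [x] and [y] have different coordinates. Hence
    neighbouring tiles come from vertices lying on a common grid line, with no
    grid plane strictly between them. A step leaves one plane and reaches another
    one, that is, it makes two "half crossings", so a chain of length [n] between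
    the tiles of [x] and [y] satisfies [nu (y - x) <= n + O(1)]. Conversely, a walk
    along a grid line realises this bound up to a constant. The unit ball of
    [nu] is a polytope: [nu] is linear on the cells of the central arrangement of
    the planes orthogonal to the [g_m], whose rays are the [h_ij]. So [y - x] is
    a nonnegative combination of the [h_ij] along which [nu] is additive, and
    walking along these grid lines in turn gives a chain of length
    [nu (y - x) + O(1)]. Tiles at distance [n] are therefore within bounded
    distance of [n M S], with [S] the unit sphere of [nu], and [M] sends the vertices
    [h_ij / nu h_ij] of the ball to the points [upsilon_ij / Delta_ij]. *)
Require Import Defs.
From HB Require Import structures.
From mathcomp Require Import all_boot all_order all_algebra.
From mathcomp Require Import classical_sets cardinality reals boolp.
From mathcomp Require Import ring lra zify.
Import Order.TTheory GRing.Theory Num.Theory.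
Local Open Scope classical_set_scope.
Local Open Scope ring_scope.
Set Implicit Arguments.
Unset Strict Implicit.
Unset Printing Implicit Defensive.

(** * Vector algebra in three-space *)

Section Vectors.
Context {R : realType}.
Local Notation V := 'rV[R]_3.
Implicit Types (u v w x : V) (s t : R).

Lemma rV3P u v : u 0 (inord 0) = v 0 (inord 0) -> u 0 (inord 1) = v 0 (inord 1) ->
  u 0 (inord 2) = v 0 (inord 2) -> u = v.
Proof.
move=> e0 e1 e2; apply/rowP => a.
have -> : a = inord a by rewrite inord_val.
by case: a => -[|[|[|//]]].
Qed.

Lemma dotpE u v : dotp u v = u 0 (inord 0) * v 0 (inord 0)
  + u 0 (inord 1) * v 0 (inord 1) + u 0 (inord 2) * v 0 (inord 2).
Proof.
rewrite /dotp !big_ord_recr big_ord0 /= add0r.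
by congr (u 0 _ * v 0 _ + u 0 _ * v 0 _ + u 0 _ * v 0 _);
  apply/val_inj; rewrite /= inordK.
Qed.

Lemma crossp0E u v : crossp u v 0 (inord 0) =
  u 0 (inord 1) * v 0 (inord 2) - u 0 (inord 2) * v 0 (inord 1).
Proof. by rewrite mxE inordK. Qed.

Lemma crossp1E u v : crossp u v 0 (inord 1) =
  u 0 (inord 2) * v 0 (inord 0) - u 0 (inord 0) * v 0 (inord 2).
Proof. by rewrite mxE inordK. Qed.

Lemma crossp2E u v : crossp u v 0 (inord 2) =
  u 0 (inord 0) * v 0 (inord 1) - u 0 (inord 1) * v 0 (inord 0).
Proof. by rewrite mxE inordK. Qed.

Definition crosspE := (crossp0E, crossp1E, crossp2E).

Lemma entryD u v a : (u + v) 0 a = u 0 a + v 0 a.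
Proof. by rewrite mxE. Qed.

Lemma entryN u a : (- u) 0 a = - u 0 a.
Proof. by rewrite mxE. Qed.

Lemma entryZ s u a : (s *: u) 0 a = s * u 0 a.
Proof. by rewrite mxE. Qed.

Lemma entry0 a : (0 : V) 0 a = 0.
Proof. by rewrite mxE. Qed.

Definition entryE := (entryD, entryN, entryZ, entry0, dotpE, crosspE).

Lemma dotpC u v : dotp u v = dotp v u.
Proof. by rewrite !dotpE; ring. Qed.

Lemma dotpDl u v w : dotp (u + v) w = dotp u w + dotp v w.
Proof. by rewrite !entryE; ring. Qed.

Lemma dotpZl s u w : dotp (s *: u) w = s * dotp u w.
Proof. by rewrite !entryE; ring. Qed.

Lemma dotpNl u w : dotp (- u) w = - dotp u w.
Proof. by rewrite !entryE; ring. Qed.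

Lemma dotpBl u v w : dotp (u - v) w = dotp u w - dotp v w.
Proof. by rewrite dotpDl dotpNl. Qed.

Lemma dotp0l w : dotp 0 w = 0.
Proof. by rewrite !entryE; ring. Qed.

Lemma dotp_suml (I : finType) (F : I -> V) w :
  dotp (\sum_i F i) w = \sum_i dotp (F i) w.
Proof.
apply: (@big_morph R V (fun u => dotp u w) 0 +%R 0 +%R) => [u v|].
  exact: dotpDl.
exact: dotp0l.
Qed.

Lemma dotpZr s u w : dotp w (s *: u) = s * dotp w u.
Proof. by rewrite dotpC dotpZl dotpC. Qed.

Lemma dotp_sumr (I : finType) (F : I -> V) w :
  dotp w (\sum_i F i) = \sum_i dotp w (F i).
Proof. by rewrite dotpC dotp_suml; apply: eq_bigr => i _; rewrite dotpC. Qed.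

Lemma dotp_ge0 u : 0 <= dotp u u.
Proof. by rewrite dotpE -!expr2 !addr_ge0 ?sqr_ge0. Qed.

Lemma dotp_eq0 u : (dotp u u == 0) = (u == 0).
Proof.
apply/eqP/eqP => [|->]; last by rewrite dotp0l.
rewrite dotpE -!expr2 => h.
have := sqr_ge0 (u 0 (inord 0)); have := sqr_ge0 (u 0 (inord 1)).
have := sqr_ge0 (u 0 (inord 2)) => h2 h1 h0.
by apply: rV3P; rewrite mxE; apply/eqP; rewrite -sqrf_eq0; apply/eqP; lra.
Qed.

Lemma dotp_crossl u v : dotp (crossp u v) u = 0.
Proof. by rewrite !entryE; ring. Qed.

Lemma dotp_crossr u v : dotp (crossp u v) v = 0.
Proof. by rewrite !entryE; ring. Qed.

Lemma crosspC u v : crossp u v = - crossp v u.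
Proof. by apply: rV3P; rewrite !entryE; ring. Qed.

Lemma crossp_colinear s t u : crossp (s *: u) (t *: u) = 0.
Proof. by apply: rV3P; rewrite !entryE; ring. Qed.

Lemma crosspp u : crossp u u = 0.
Proof. by rewrite -[u]scale1r crossp_colinear. Qed.

Lemma crossp_eq0_colinear u v : dotp u u = 1 -> crossp u v = 0 -> v = dotp u v *: u.
Proof.
move=> u1 uv0; have : dotp u u *: v = dotp u v *: u - crossp u (crossp u v).
  by apply: rV3P; rewrite !entryE; ring.
rewrite u1 uv0 scale1r => {1}->.
by apply: rV3P; rewrite !entryE; ring.
Qed.

(** Recovers [x] from its scalar products with three independent vectors; uniqueness, existence and
    uniform bounds for such systems rest on this identity. *)
Lemma cramer u v w x : dotp (crossp u v) w *: x =
  dotp x u *: crossp v w + dotp x v *: crossp w u + dotp x w *: crossp u v.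
Proof. by apply: rV3P; rewrite !entryE; ring. Qed.

Lemma triple_rot u v w : dotp (crossp v w) u = dotp (crossp u v) w.
Proof. by rewrite !entryE; ring. Qed.

Lemma det_rows3 u v w : \det (rows3 u v w) = dotp (crossp u v) w.
Proof.
have liftE (a : 'I_3) (b : 'I_2) : lift a b = inord (bump a b).
  by apply/val_inj; rewrite /= inordK // (ltn_ord (lift a b)).
have widenE (a : 'I_2) : widen_ord (leqnSn 2) a = inord a.
  by apply/val_inj; rewrite /= inordK // ltnW // ltnS ltn_ord.
have maxE : ord_max = inord 2 :> 'I_3 by apply/val_inj; rewrite /= inordK.
rewrite dotpE !crosspE (expand_det_row _ ord0) !big_ord_recr big_ord0 /= add0r.
rewrite /cofactor !(expand_det_row _ ord0) !big_ord_recr !big_ord0 /= !add0r.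
rewrite /cofactor !det_mx11 !mxE /=.
by rewrite !liftE /bump /= !widenE !maxE /=; ring.
Qed.

(** Lagrange's identity: the difference of the two sides is the squared length of the cross
    product. *)
Lemma dotp_sqr_le u v : dotp u v ^+ 2 <= dotp u u * dotp v v.
Proof.
rewrite -subr_ge0 (_ : _ - _ = dotp (crossp u v) (crossp u v)) ?dotp_ge0 //.
by rewrite !entryE; ring.
Qed.

Lemma vnorm_ge0 u : 0 <= vnorm u.
Proof. exact: sqrtr_ge0. Qed.

Lemma sqr_vnorm u : vnorm u ^+ 2 = dotp u u.
Proof. by rewrite sqr_sqrtr ?dotp_ge0. Qed.

Lemma vnorm_eq0 u : (vnorm u == 0) = (u == 0).
Proof. by rewrite -sqrf_eq0 sqr_vnorm dotp_eq0. Qed.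

Lemma dotp_le_vnorm u v : `|dotp u v| <= vnorm u * vnorm v.
Proof.
rewrite -(@ler_pXn2r _ 2) ?nnegrE ?normr_ge0 ?mulr_ge0 ?vnorm_ge0 //.
by rewrite exprMn !sqr_vnorm -normrX ger0_norm ?sqr_ge0 ?dotp_sqr_le.
Qed.

Lemma vnormZ s u : vnorm (s *: u) = `|s| * vnorm u.
Proof.
apply/eqP; rewrite -(@eqrXn2 _ 2) ?mulr_ge0 ?vnorm_ge0 //.
by rewrite exprMn !sqr_vnorm dotpZl dotpZr mulrA real_normK ?num_real ?expr2.
Qed.

Lemma vnormD u v : vnorm (u + v) <= vnorm u + vnorm v.
Proof.
rewrite -(@ler_pXn2r _ 2) ?nnegrE ?addr_ge0 ?vnorm_ge0 //.
rewrite sqrrD !sqr_vnorm dotpDl !(dotpC _ (u + v)) !dotpDl (dotpC v u).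
have := ler_norm (dotp u v); have := dotp_le_vnorm u v; lra.
Qed.

Lemma vnorm0 : vnorm (0 : V) = 0.
Proof. by apply/eqP; rewrite vnorm_eq0. Qed.

Lemma vnorm_sum (I : finType) (F : I -> V) :
  vnorm (\sum_i F i) <= \sum_i vnorm (F i).
Proof.
apply: (big_ind2 (fun u s => vnorm u <= s)) => [|u s v t hu hv|//].
  by rewrite vnorm0.
exact: le_trans (vnormD _ _) (lerD hu hv).
Qed.

End Vectors.

(** * Ceilings, floors and half crossings for one family of planes *)

Section Steps.
Context {R : realType}.
Implicit Types (s t c d : R).

(** The range of one coefficient over the tile of a vertex with coordinate [t]: a single point off
    the planes, an interval of length 1 when [t] is an integer. *)
Definition cbox t c := (Num.ceil t)%:~R <= c <= (Num.floor t + 1)%:~R.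

(** Counts half crossings: the value is [2n] at an integer [n] and [2n + 1] strictly between [n] and
    [n + 1], so reaching a plane and leaving it each add 1. *)
Definition kappa t : int := Num.ceil t + Num.floor t.

(* [lia] compares atoms syntactically, hence this copy of [ceil_floor] (and of
   [le_floor]) at the canonical instances of a [realType]. *)
Lemma ceilE t : Num.ceil t = Num.floor t + (t \isn't a Num.int).
Proof. exact: ceil_floor. Qed.

Lemma floor_mono s t : s <= t -> Num.floor s <= Num.floor t.
Proof. exact: le_floor. Qed.

Lemma ceil_nint t : t \isn't a Num.int -> Num.ceil t = Num.floor t + 1.
Proof. by move=> tZ; rewrite ceilE tZ. Qed.

Lemma ceil_int t : t \is a Num.int -> Num.ceil t = Num.floor t.
Proof. by move=> tZ; rewrite ceilE tZ addr0. Qed.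

Lemma ceil_le_floorD1 t : Num.ceil t <= Num.floor t + 1.
Proof. by rewrite ceilE; case: (t \is a Num.int) => /=; lia. Qed.

Lemma floor_lt_ceil s t : s < t -> Num.floor s < Num.ceil t.
Proof. by move=> st; rewrite ceil_gt_int; apply: le_lt_trans (floor_le s) st. Qed.

Lemma cbox_ceil t : cbox t (Num.ceil t)%:~R.
Proof. by rewrite /cbox lexx ler_int ceil_le_floorD1. Qed.

Lemma cbox_floorD1 t : cbox t (Num.floor t + 1)%:~R.
Proof. by rewrite /cbox lexx ler_int ceil_le_floorD1. Qed.

Lemma cbox_near t c : cbox t c -> `|c - t| <= 1.
Proof.
case/andP => h1 h2; rewrite ler_norml.
have := ceil_ge t; have := floor_le t; rewrite intrD in h2; lra.
Qed.

Lemma cbox_le s t c d : cbox s c -> cbox t d -> s < t -> c <= d.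
Proof.
move=> /andP[_ c_le] /andP[d_ge _] st; apply: le_trans c_le (le_trans _ d_ge).
by rewrite ler_int lezD1 floor_lt_ceil.
Qed.

Lemma cbox_monotone s t c d : cbox s c -> cbox t d -> 0 <= (c - d) * (s - t).
Proof.
move=> sc td; have [st|ts|->] := ltgtP s t; last by rewrite subrr mulr0.
  by have := cbox_le sc td st => cd; nra.
by have := cbox_le td sc ts => cd; nra.
Qed.

Lemma cbox_nint t c : t \isn't a Num.int -> cbox t c -> c = (Num.ceil t)%:~R.
Proof.
move=> tZ; rewrite /cbox -(ceil_nint tZ) => h; apply/eqP.
by rewrite eq_le andbC.
Qed.

(** The first box ends at [floor s + 1] and the second begins at [ceil t], which is no smaller
    because [s < t]; a common point must be both. *)
Lemma cbox_lt s t c : s < t -> cbox s c -> cbox t c ->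
  c = (Num.ceil t)%:~R /\ Num.ceil t = Num.floor s + 1.
Proof.
move=> st /andP[_ cs] /andP[ct _].
have cE : Num.ceil t = Num.floor s + 1.
  apply/eqP; rewrite eq_le lezD1 floor_lt_ceil // andbT -(ler_int R).
  exact: le_trans ct cs.
by split=> //; apply/eqP; rewrite eq_le ct andbT cE.
Qed.

Lemma cbox_neq s t c d : s != t -> cbox s c -> cbox t c -> cbox s d -> cbox t d -> c = d.
Proof.
move=> st sc tc sd td; have [lt|lt|eq] := ltgtP s t; last by rewrite eq eqxx in st.
  by have [-> _] := cbox_lt lt sc tc; have [-> _] := cbox_lt lt sd td.
by have [-> _] := cbox_lt lt tc sc; have [-> _] := cbox_lt lt td sd.
Qed.

(** If the boxes meet and [s < t], then [ceil t = floor s + 1], so the only half crossings are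
    leaving a plane at [s] and reaching one at [t], when these values are integers. *)
Lemma kappa_cbox s t c : cbox s c -> cbox t c ->
  (`|kappa s - kappa t| <= (s \is a Num.int) + (t \is a Num.int))%N.
Proof.
wlog st : s t / s <= t => [wl sc tc|].
  have [/wl|/ltW/wl] := leP s t; first by apply.
  by move=> /(_ tc sc); rewrite addnC distnC.
move: st; rewrite le_eqVlt => /predU1P[-> _ _|st sc tc]; first by rewrite subrr.
have [_] := cbox_lt st sc tc; rewrite /kappa.
rewrite !ceilE; case: (s \is a Num.int); case: (t \is a Num.int) => /=; lia.
Qed.

Lemma kappa_approx t : `|(kappa t)%:~R - 2 * t| <= 1.
Proof.
rewrite /kappa intrD ler_norml.
have := ceil_ge t; have := floor_le t; have := floorD1_gt t; have := ceilB1_lt t.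
rewrite intrB intrD; lra.
Qed.

Lemma le_kappa s t : s <= t -> kappa s <= kappa t.
Proof. by move=> st; rewrite lerD ?le_ceil ?le_floor. Qed.

Lemma kappa_between s t r : s <= t -> t <= r ->
  (`|kappa s - kappa t| + `|kappa t - kappa r| = `|kappa s - kappa r|)%N.
Proof. by move=> /le_kappa + /le_kappa; lia. Qed.

Lemma lt_kappa s t : s < t ->
  kappa s + (s \is a Num.int) + (t \is a Num.int) <= kappa t.
Proof.
move=> st; have := floor_lt_ceil st; rewrite /kappa !ceilE.
have := floor_mono (ltW st).
case: (boolP (s \is a Num.int)) => sZ; case: (boolP (t \is a Num.int)) => tZ /=; lia.
Qed.

Lemma kappa_neq s t : s != t ->
  ((s \is a Num.int) + (t \is a Num.int) <= `|kappa s - kappa t|)%N.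
Proof.
case: ltgtP => // /lt_kappa; lia.
Qed.

End Steps.

Lemma fin_lower_bound (R : realType) (I : finType) (F : I -> R) :
  (forall i, 0 < F i) -> exists2 e, 0 < e & forall i, e <= F i.
Proof.
move=> F_gt0; have inv_gt0 i : 0 < (F i)^-1 by rewrite invr_gt0.
have S_ge0 : 0 <= \sum_i (F i)^-1 by apply: sumr_ge0 => i _; apply: ltW.
(* The summand 1 keeps this witness positive for an empty index type as well. *)
exists (1 + \sum_i (F i)^-1)^-1; first by rewrite invr_gt0 ltr_wpDr.
move=> i; rewrite -[leRHS]invrK lef_pV2 ?posrE ?ltr_wpDr //.
rewrite (bigD1 i) //= addrCA lerDl addr_ge0 // sumr_ge0 // => j _.
exact: ltW.
Qed.

(** * The norm nu, the operator M and independent triples of normals *)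

Section Configuration.
Context {R : realType} {N : nat} (g : 'I_N -> 'rV[R]_3) (gamma : 'I_N -> R).
Local Notation V := 'rV[R]_3.
Implicit Types (u v w x y z p q : V) (i j k l m : 'I_N) (s t : R).

(** [gnorm] and [frame] are nu and M; up to a bounded error, [gnorm u] is the number of grid planes
    crossed by a displacement [u]. *)
Definition gnorm u : R := \sum_m `|dotp u (g m)|.
Definition frame u : V := \sum_m dotp u (g m) *: g m.
Definition comb (c : 'I_N -> R) : V := \sum_m c m *: g m.
Definition coord m x : R := dotp x (g m) - gamma m.

Lemma gnorm_ge0 u : 0 <= gnorm u.
Proof. by apply: sumr_ge0 => m _; apply: normr_ge0. Qed.

Lemma gnorm0 : gnorm 0 = 0.
Proof. by apply: big1 => m _; rewrite dotp0l normr0. Qed.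

Lemma gnormZ s u : gnorm (s *: u) = `|s| * gnorm u.
Proof. by rewrite /gnorm mulr_sumr; apply: eq_bigr => m _; rewrite dotpZl normrM. Qed.

Lemma gnormN u : gnorm (- u) = gnorm u.
Proof. by rewrite -scaleN1r gnormZ normrN1 mul1r. Qed.

Lemma gnormB u v : gnorm (u - v) = gnorm (v - u).
Proof. by rewrite -gnormN opprB. Qed.

Lemma gnormD u v : gnorm (u + v) <= gnorm u + gnorm v.
Proof. by rewrite -big_split ler_sum // => m _; rewrite dotpDl ler_normD. Qed.

Lemma gnorm_dist u v w : gnorm (u - w) <= gnorm (u - v) + gnorm (v - w).
Proof. by have := gnormD (u - v) (v - w); rewrite addrA subrK. Qed.

Lemma gnorm_sum (I : finType) (F : I -> V) : gnorm (\sum_i F i) <= \sum_i gnorm (F i).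
Proof.
apply: (big_ind2 (fun u s => gnorm u <= s)) => [|u s v t hu hv|//].
  by rewrite gnorm0.
exact: le_trans (gnormD _ _) (lerD hu hv).
Qed.

Lemma frameZ s u : frame (s *: u) = s *: frame u.
Proof.
by rewrite /frame scaler_sumr; apply: eq_bigr => m _; rewrite dotpZl scalerA.
Qed.

Lemma frameD u v : frame (u + v) = frame u + frame v.
Proof. by rewrite -big_split; apply: eq_bigr => m _; rewrite dotpDl scalerDl. Qed.

Lemma frameB u v : frame (u - v) = frame u - frame v.
Proof. by rewrite frameD -(scaleN1r v) frameZ scaleN1r. Qed.

Lemma frame0 : frame 0 = 0.
Proof. by rewrite -[X in frame X](scale0r 0) frameZ scale0r. Qed.

Lemma frame_sum (I : finType) (F : I -> V) : frame (\sum_i F i) = \sum_i frame (F i).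
Proof.
apply: (@big_morph V V frame 0 +%R 0 +%R); [exact: frameD | exact: frame0].
Qed.

Lemma combB (c d : 'I_N -> R) : comb c - comb d = \sum_m (c m - d m) *: g m.
Proof. by rewrite -sumrB; apply: eq_bigr => m _; rewrite scalerBl. Qed.

Lemma coordB m x y : coord m x - coord m y = dotp (x - y) (g m).
Proof. by rewrite dotpBl /coord; ring. Qed.

Lemma coordD m x u : coord m (x + u) = coord m x + dotp u (g m).
Proof. by rewrite /coord dotpDl; ring. Qed.

Lemma on_planeP m x : reflect (on_plane g gamma m x) (coord m x \is a Num.int).
Proof. exact: intrP. Qed.

Context (g_unit : forall m, vnorm (g m) = 1).

Lemma g_dot1 m : dotp (g m) (g m) = 1.
Proof. by rewrite -sqr_vnorm g_unit expr1n. Qed.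

Lemma vnorm_comb (c : 'I_N -> R) : vnorm (comb c) <= \sum_m `|c m|.
Proof.
apply: le_trans (vnorm_sum _) _; apply: ler_sum => m _.
by rewrite vnormZ g_unit mulr1.
Qed.

Lemma vnorm_frame u : vnorm (frame u) <= gnorm u.
Proof. exact: vnorm_comb. Qed.

Lemma gnorm_le_vnorm u m : `|dotp u (g m)| <= vnorm u.
Proof. by apply: le_trans (dotp_le_vnorm _ _) _; rewrite g_unit mulr1. Qed.

Context (g_indep : forall i j k, i != j -> i != k -> j != k ->
  dotp (hvec g i j) (g k) != 0).

Lemma dot3_eq0 i j k u : i != j -> i != k -> j != k ->
  dotp u (g i) = 0 -> dotp u (g j) = 0 -> dotp u (g k) = 0 -> u = 0.
Proof.
move=> ij ik jk ui uj uk; have := cramer (g i) (g j) (g k) u.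
rewrite ui uj uk !scale0r !addr0 => /eqP.
by rewrite scaler_eq0 (negPf (g_indep ij ik jk)) => /eqP.
Qed.

Lemma dot3_solve i j k (s : 'I_N -> R) : i != j -> i != k -> j != k ->
  exists u, [/\ dotp u (g i) = s i, dotp u (g j) = s j & dotp u (g k) = s k].
Proof.
move=> ij ik jk; set D := dotp (hvec g i j) (g k).
have D0 : D != 0 by apply: g_indep.
exists (D^-1 *: (s i *: crossp (g j) (g k) + s j *: crossp (g k) (g i)
                 + s k *: crossp (g i) (g j))).
have E1 : dotp (crossp (g j) (g k)) (g i) = D by rewrite triple_rot.
have E2 : dotp (crossp (g k) (g i)) (g j) = D by rewrite triple_rot.
by split; rewrite dotpZl !dotpDl !dotpZl ?dotp_crossl ?dotp_crossr ?E1 ?E2;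
  rewrite ?mulr0 ?add0r ?addr0 mulrCA mulVf // mulr1.
Qed.

(** Cramer's rule gives a constant for each triple, and the sum over the finitely many triples
    serves for all of them. Degenerate triples add 0, the inverse of 0 being 0. *)
Lemma gnorm_le_triple : exists2 A : R, 0 <= A &
  forall i j k u, i != j -> i != k -> j != k ->
  gnorm u <= A * (`|dotp u (g i)| + `|dotp u (g j)| + `|dotp u (g k)|).
Proof.
pose D (a : 'I_N * 'I_N * 'I_N) := dotp (hvec g a.1.1 a.1.2) (g a.2).
pose B (a : 'I_N * 'I_N * 'I_N) := `|D a|^-1 * (gnorm (hvec g a.1.2 a.2)
  + gnorm (hvec g a.2 a.1.1) + gnorm (hvec g a.1.1 a.1.2)).
have B_ge0 a : 0 <= B a.
  by rewrite mulr_ge0 ?invr_ge0 ?normr_ge0 // !addr_ge0 ?gnorm_ge0.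
exists (\sum_a B a) => [|i j k u ij ik jk]; first exact: sumr_ge0.
have hB : B (i, j, k) <= \sum_a B a.
  by rewrite (bigD1 (i, j, k)) //= lerDl sumr_ge0.
set S := _ + _ + _; have S_ge0 : 0 <= S by rewrite !addr_ge0 ?normr_ge0.
apply: le_trans (ler_wpM2r S_ge0 hB); rewrite /B /D /=.
have D0 := g_indep ij ik jk.
have := congr1 gnorm (cramer (g i) (g j) (g k) u); rewrite gnormZ => uE.
rewrite -mulrA ler_pdivlMl ?normr_gt0 // uE.
apply: le_trans (gnormD _ _) _.
apply: le_trans (lerD (gnormD _ _) (lexx _)) _.
rewrite !gnormZ /hvec [leRHS]mulrC !mulrDr.
have Si : `|dotp u (g i)| <= S by rewrite /S -addrA lerDl addr_ge0.
have Sj : `|dotp u (g j)| <= S by rewrite /S addrAC lerDr addr_ge0.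
have Sk : `|dotp u (g k)| <= S by rewrite /S lerDr addr_ge0.
by rewrite !lerD // ler_wpM2r ?gnorm_ge0.
Qed.

Context (N_gt2 : (2 < N)%N).

Lemma third_index i j : exists k, (i != k) && (j != k).
Proof.
have : ~~ ([set: 'I_N]%SET \subset [set i; j]%SET).
  by apply/negP => /subset_leq_card; rewrite cardsT card_ord cards2; lia.
case/subsetPn => k _; rewrite !inE negb_or => /andP[ki kj].
by exists k; rewrite !(eq_sym _ k) ki.
Qed.

Lemma hvec_neq0 i j : i != j -> hvec g i j != 0.
Proof.
move=> ij; have [k /andP[ik jk]] := third_index i j.
by apply: contraNneq (g_indep ij ik jk) => ->; rewrite dotp0l.
Qed.

Lemma dotp_hvec_eq0 i j k : i != j -> (dotp (hvec g i j) (g k) == 0) = (k == i) || (k == j).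
Proof.
move=> ij; have [->|ki] := eqVneq k i; first by rewrite dotp_crossl eqxx.
have [->|kj] := eqVneq k j; first by rewrite dotp_crossr eqxx.
by apply/negbTE/g_indep; rewrite // eq_sym.
Qed.

(** Matching the scalar product with a third normal leaves a difference orthogonal to three
    independent normals. *)
Lemma orth2_hvec i j u : i != j -> dotp u (g i) = 0 -> dotp u (g j) = 0 ->
  exists t, u = t *: hvec g i j.
Proof.
move=> ij ui uj; have [k /andP[ik jk]] := third_index i j.
have D0 := g_indep ij ik jk; exists (dotp u (g k) / dotp (hvec g i j) (g k)).
apply/eqP; rewrite -subr_eq0; apply/eqP/(dot3_eq0 ij ik jk);
  by rewrite dotpBl dotpZl ?dotp_crossl ?dotp_crossr ?ui ?uj ?mulr0 ?subr0 ?divfK ?subrr.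
Qed.

Lemma gnorm_eq0 u : (gnorm u == 0) = (u == 0).
Proof.
apply/idP/eqP => [|->]; last by rewrite gnorm0.
rewrite psumr_eq0 => [/allP u0|m _]; last exact: normr_ge0.
have um m : dotp u (g m) = 0.
  by apply/eqP; rewrite -normr_eq0; apply: u0; rewrite mem_index_enum.
have [k /andP[ik jk]] := third_index (Ordinal (ltnW (ltnW N_gt2))) (Ordinal (ltnW N_gt2)).
exact: (dot3_eq0 _ ik jk).
Qed.

Lemma dotp_frame u : dotp (frame u) u = \sum_m dotp u (g m) ^+ 2.
Proof.
by rewrite dotp_suml; apply: eq_bigr => m _; rewrite dotpZl (dotpC (g m)) expr2.
Qed.

(** M is positive definite: pairing [frame (u - v)] with [u - v] gives the sum of the squares of all
    scalar products with the normals. *)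
Lemma frame_inj u v : frame u = frame v -> u = v.
Proof.
move=> uv; apply/eqP; rewrite -subr_eq0 -gnorm_eq0.
have := dotp_frame (u - v); rewrite frameB uv subrr dotp0l.
move/esym/eqP; rewrite psumr_eq0 => [/allP h|m _]; last exact: sqr_ge0.
rewrite psumr_eq0 => [|m _]; last exact: normr_ge0.
by apply/allP => m /h /=; rewrite sqrf_eq0 normr_eq0.
Qed.

Lemma hvecC i j : hvec g i j = - hvec g j i.
Proof. exact: crosspC. Qed.

Lemma hvecii i : hvec g i i = 0.
Proof. exact: crosspp. Qed.

End Configuration.

(** * Ceilings near a given coordinate *)

Section Window.
Context {R : realType}.
Implicit Types (s t r : R).

(** The largest open interval around [t] that contains no integer except possibly [t]. *)
Definition window t s := (Num.ceil t - 1)%:~R < s < (Num.floor t + 1)%:~R.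

Lemma window_near t : exists2 r, 0 < r & forall s, `|s - t| < r -> window t s.
Proof.
exists (Num.min (t - (Num.ceil t - 1)%:~R) ((Num.floor t + 1)%:~R - t)).
  by rewrite lt_min !subr_gt0 ceilB1_lt floorD1_gt.
move=> s; rewrite lt_min !ltr_norml /window => /andP[/andP[h1 h2] /andP[h3 h4]].
by apply/andP; split; lra.
Qed.

Lemma window_cbox t s : window t s -> cbox t (Num.ceil s)%:~R.
Proof.
case/andP => h1 h2; rewrite /cbox !ler_int; apply/andP; split.
  have : Num.ceil t - 1 < Num.ceil s by rewrite ceil_gt_int; exact: h1.
  lia.
by rewrite ceil_le_int; apply: ltW; exact: h2.
Qed.

Lemma window_ceil t s : window t s -> (t \is a Num.int -> s != t) ->
  s \isn't a Num.int /\ Num.ceil s = if s < t then Num.ceil t else Num.floor t + 1.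
Proof.
case/andP => h1 h2 st.
have between (n : int) : n%:~R < s -> s < (n + 1)%:~R ->
    s \isn't a Num.int /\ Num.ceil s = n + 1.
  move=> ns sn; split; last by apply: ceil_def; rewrite addrK ns ltW.
  by apply/negP => /intrP[z zE]; move: ns sn; rewrite zE !ltr_int; lia.
have [tZ|tZ] := boolP (t \is a Num.int).
  have tE : t = (Num.floor t)%:~R by rewrite floorK.
  rewrite ceil_int // in h1 *; case: ltgtP (st tZ) => // lt _.
    have [|sZ ->] := between (Num.floor t - 1) h1.
      by rewrite subrK -tE.
    by rewrite subrK.
  by apply: between => //; rewrite -tE.
rewrite (ceil_nint tZ) if_same; apply: between => //.
by move: h1; rewrite ceil_nint // addrK.
Qed.

End Window.

Lemma sub_conv {R : realType} (A : set 'rV[R]_3) y : A y -> conv A y.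
Proof.
move=> Ay; exists 1%N, (fun=> y), (fun=> 1).
by rewrite !big_ord_recr !big_ord0 /= !add0r scale1r.
Qed.

Lemma mean_ge {R : realType} n (l c : 'I_n -> R) s :
  (forall a, 0 <= l a) -> \sum_a l a = 1 -> (forall a, s <= c a) ->
  s <= \sum_a l a * c a.
Proof.
move=> l_ge0 l1 sc; rewrite -[s]mul1r -l1 mulr_suml; apply: ler_sum => a _.
by rewrite ler_wpM2l.
Qed.

Lemma mean_le {R : realType} n (l c : 'I_n -> R) s :
  (forall a, 0 <= l a) -> \sum_a l a = 1 -> (forall a, c a <= s) ->
  \sum_a l a * c a <= s.
Proof.
move=> l_ge0 l1 cs; rewrite -[s]mul1r -l1 mulr_suml; apply: ler_sum => a _.
by rewrite ler_wpM2l.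
Qed.

(** * Tiles described by coefficients *)

Section Tiles.
Context {R : realType} {N : nat} (g : 'I_N -> 'rV[R]_3) (gamma : 'I_N -> R).
Local Notation V := 'rV[R]_3.
Local Notation coord := (coord g gamma).
Local Notation comb := (comb g).
Local Notation gnorm := (gnorm g).
Implicit Types (u v w x y z p q : V) (i j k l m : 'I_N) (s t : R).
Context (g_unit : forall m, vnorm (g m) = 1).

(** Convex combinations can be formed coefficient by coefficient, so constraints stable under means
    pass to the convex hull. *)
Lemma conv_comb (A : set V) (P : 'I_N -> R -> Prop) :
  (forall m n (l c : 'I_n -> R), (forall a, 0 <= l a) -> \sum_a l a = 1 ->
     (forall a, P m (c a)) -> P m (\sum_a l a * c a)) ->
  (forall p, A p -> exists2 c, forall m, P m (c m) & p = comb c) ->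
  forall p, conv A p -> exists2 c, forall m, P m (c m) & p = comb c.
Proof.
move=> convP AP p [n [q [l [Aq [l_ge0 [l1 ->]]]]]].
have /fin_all_exists[c cE] a : exists c, (forall m, P m (c m)) /\ q a = comb c.
  by have [c ? ?] := AP _ (Aq a); exists c.
exists (fun m => \sum_a l a * c a m) => [m|].
  by apply: convP => // a; have [] := cE a.
under [RHS]eq_bigr => m _ do rewrite scaler_suml.
rewrite exchange_big; apply: eq_bigr => a _; have [_ ->] := cE a.
by rewrite scaler_sumr; apply: eq_bigr => m _; rewrite scalerA.
Qed.

Lemma windows_near x : exists2 r, 0 < r & forall y m,
  vnorm (y - x) < r -> window (coord m x) (coord m y).
Proof.
have /fin_all_exists[r rE] m : exists r, 0 < r /\
    forall s, `|s - coord m x| < r -> window (coord m x) s.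
  by have [r ? ?] := window_near (coord m x); exists r.
have [m|e e0 er] := @fin_lower_bound _ _ r; first by have [] := rE m.
exists e => // y m yx; have [_] := rE m; apply; rewrite coordB.
exact: le_lt_trans (gnorm_le_vnorm g_unit _ _) (lt_le_trans yx (er m)).
Qed.

(** Close to [x] all coordinates stay in their windows, so their ceilings lie in the boxes; boxes
    are convex. *)
Lemma tile_box x p : tile g gamma x p ->
  exists2 c, forall m, cbox (coord m x) (c m) & p = comb c.
Proof.
apply: (conv_comb (P := fun m c => cbox (coord m x) c)).
  move=> m n l c l_ge0 l1 cP; apply/andP; split.
    exact: (mean_ge l_ge0 l1 (fun a => proj1 (andP (cP a)))).
  exact: (mean_le l_ge0 l1 (fun a => proj2 (andP (cP a)))).
move=> q xq; have [r r0 rP] := windows_near x; have [y [yx [_ <-]]] := xq r r0.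
exists (fun m => (Ki g gamma m y)%:~R) => // m.
exact/window_cbox/rP.
Qed.

Context (g_indep : forall i j k, i != j -> i != k -> j != k ->
  dotp (hvec g i j) (g k) != 0).
Context (g_reg : regular_grid g gamma).

Lemma card_on x : (#|[set m | coord m x \is a Num.int]%SET| <= 3)%N.
Proof. by apply: (g_reg (x := x)) => m; rewrite inE => /on_planeP. Qed.

(** A fourth plane through [x] would contradict regularity. *)
Lemma on_cases x i j k : i != j -> i != k -> j != k ->
  coord i x \is a Num.int -> coord j x \is a Num.int -> coord k x \is a Num.int ->
  forall m, coord m x \is a Num.int -> [|| m == i, m == j | m == k].
Proof.
move=> ij ik jk xi xj xk m xm; apply: contraT; rewrite !negb_or => /and3P[mi mj mk].
have : ([set m; i; j; k]%SET \subset [set m | coord m x \is a Num.int]%SET).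
  by apply/fintype.subsetP => a; rewrite !inE -!orbA => /or4P[] /eqP ->.
move/subset_leq_card; have := card_on x.
rewrite -!finset.setUA !cardsU1 cards1 !inE !negb_or mi mj mk ij ik jk /=; lia.
Qed.

(** [b m] selects the lower or the upper side of the plane of family [m] through [x]; where there is
    no such plane the two values agree. *)
Definition corner (b : 'I_N -> bool) x : V := comb (fun m =>
  (if b m then Num.ceil (coord m x) else Num.floor (coord m x) + 1)%:~R).

(** The three normals of the planes through [x] are independent, so some direction points to the
    prescribed side of each plane. A short step in it enters the cell whose K-image is the
    corner. *)
Lemma tile_corner b x : ipoint g gamma x -> tile g gamma x (corner b x).
Proof.
case=> i [j [k [[ij ik jk] [/on_planeP xi /on_planeP xj /on_planeP xk]]]].
have onx := on_cases ij ik jk xi xj xk.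
have [u [ui uj uk]] := dot3_solve g_indep (fun m => if b m then -1 else 1) ij ik jk.
have um m : coord m x \is a Num.int -> dotp u (g m) = if b m then -1 else 1.
  by move/onx/or3P => [] /eqP ->.
apply: sub_conv => r r0; have [e e0 eP] := windows_near x.
(* Short enough to stay in the given ball and in all windows; the 1 makes the inequality strict and
   the denominator nonzero. *)
pose d := Num.min r e / (1 + vnorm u).
have u0 : 0 < 1 + vnorm u by rewrite ltr_wpDr ?vnorm_ge0.
have d0 : 0 < d by rewrite divr_gt0 // lt_min r0.
have dE : vnorm (d *: u) < Num.min r e.
  rewrite vnormZ gtr0_norm // /d mulrAC ltr_pdivrMr //.
  by rewrite ltr_pM2l ?ltrDr // lt_min r0.
have yx : x + d *: u - x = d *: u by rewrite addrAC subrr add0r.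
have nearE m : coord m (x + d *: u) \isn't a Num.int /\ Ki g gamma m (x + d *: u) =
    if b m then Num.ceil (coord m x) else Num.floor (coord m x) + 1.
  have [|xZ|yZ yE] := @window_ceil _ (coord m x) (coord m (x + d *: u)).
  - by apply: eP; rewrite yx (lt_le_trans dE) // ge_min lexx orbT.
  - rewrite -subr_eq0 coordB yx dotpZl mulf_neq0 ?(gt_eqF d0) // um //.
    by case: (b m); rewrite ?oppr_eq0 oner_eq0.
  split=> //; rewrite [LHS]yE; have [xZ|xZ] := boolP (coord m x \is a Num.int).
    rewrite -subr_lt0 coordB yx dotpZl pmulr_rlt0 // um //.
    by case: (b m); rewrite ?ltrN10 // ltr10.
  by rewrite ceil_nint // !if_same.
exists (x + d *: u); split; first by rewrite yx (lt_le_trans dE) // ge_min lexx.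
split=> [m|]; first by apply/on_planeP; have [] := nearE m.
by apply: eq_bigr => m _; have [_ ->] := nearE m.
Qed.

(** Pairing [comb c - comb d = 0] with [v - w] gives a vanishing sum of products of coefficient and
    coordinate differences. Each product is nonnegative because boxes are monotone, hence each is
    0. *)
Lemma comb_eq_coords v w (c d : 'I_N -> R) :
  (forall m, cbox (coord m v) (c m)) -> (forall m, cbox (coord m w) (d m)) ->
  comb c = comb d -> forall m, coord m v != coord m w -> c m = d m.
Proof.
move=> vc wd cd m vw.
have : \sum_m (c m - d m) * (coord m v - coord m w) = 0.
  under eq_bigr => a _ do rewrite coordB dotpC -dotpZl.
  by rewrite -dotp_suml -combB cd subrr dotp0l.
move/eqP; rewrite psumr_eq0 => [/allP h|a _]; last exact: cbox_monotone.
have := h m; rewrite mem_index_enum => /(_ isT) /=.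
by rewrite mulf_eq0 !subr_eq0 (negPf vw) orbF => /eqP.
Qed.

End Tiles.

(** * Half crossings along chains and walks along grid lines *)

Section Walks.
Context {R : realType} {N : nat} (g : 'I_N -> 'rV[R]_3) (gamma : 'I_N -> R).
Local Notation V := 'rV[R]_3.
Local Notation coord := (coord g gamma).
Local Notation comb := (comb g).
Local Notation gnorm := (gnorm g).
Local Notation tile := (tile g gamma).
Local Notation ipoint := (ipoint g gamma).
Local Notation corner := (corner g gamma).
Implicit Types (u v w x y z p q : V) (i j k l m : 'I_N) (s t : R).
Context (g_unit : forall m, vnorm (g m) = 1).
Context (g_reg : regular_grid g gamma).

(** The number of half crossings between [v] and [w]: a plane strictly between them counts 2, a
    plane through exactly one of them counts 1. *)
Definition sep v w : nat :=
  (\sum_m `|kappa (coord m v) - kappa (coord m w)|)%N.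

Lemma sepC v w : sep v w = sep w v.
Proof. by apply: eq_bigr => m _; rewrite distnC. Qed.

Lemma sep_triangle v u w : (sep v w <= sep v u + sep u w)%N.
Proof. by rewrite -big_split leq_sum // => m _ /=; lia. Qed.

Lemma sepvv v : sep v v = 0%N.
Proof. by apply: big1 => m _; rewrite subrr. Qed.

Lemma sep_gnorm v w : `|(sep v w)%:R - 2 * gnorm (v - w)| <= 2 * N%:R.
Proof.
have -> : 2 * N%:R = \sum_(m < N) 2 :> R.
  by rewrite sumr_const card_ord mulr_natr.
rewrite /sep natr_sum mulr_sumr -sumrB (le_trans (ler_norm_sum _ _ _)) //.
apply: ler_sum => m _; rewrite -(coordB g gamma) natr_absz intr_norm intrB.
have := kappa_approx (coord m v); have := kappa_approx (coord m w).
move: (coord m v) (coord m w) => a b.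
rewrite !ler_norml => /andP[h1 h2] /andP[h3 h4].
by apply/andP; split; do 2! [case: ler0P => ?]; lra.
Qed.

Definition shared v w := [set m | (coord m v == coord m w) && (coord m v \is a Num.int)]%SET.

(** On the intersection of two tiles a coefficient can vary only if one plane of its family contains
    both vertices: if the coordinates differ the two boxes share at most one point, and if they
    agree off the integers the box itself is a point. *)
Lemma shared_coords v w (c d : 'I_N -> R) :
  (forall m, cbox (coord m v) (c m)) -> (forall m, cbox (coord m v) (d m)) ->
  tile w (comb c) -> tile w (comb d) ->
  forall m, m \notin shared v w -> c m = d m.
Proof.
move=> vc vd /(tile_box g_unit)[c' wc cc'] /(tile_box g_unit)[d' wd dd'] m.
rewrite inE; have [vw|vw _] := eqVneq (coord m v) (coord m w).
  by move=> /= vZ; rewrite (cbox_nint vZ (vc m)) (cbox_nint vZ (vd m)).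
apply: (cbox_neq vw) => //.
  by rewrite (comb_eq_coords vc wc cc' vw).
by rewrite (comb_eq_coords vd wd dd' vw).
Qed.

(** One free coefficient sweeps out only a line, so three non-collinear common points of two tiles
    require two shared planes. *)
Lemma comb_line (F : {set 'I_N}) : (#|F| <= 1)%N -> exists e, forall c d : 'I_N -> R,
  (forall m, m \notin F -> c m = d m) -> exists s, comb c - comb d = s *: e.
Proof.
rewrite leq_eqVlt ltnS leqn0 => /orP[/cards1P[i ->]|/eqP/cards0_eq ->].
  exists (g i) => c d cd; exists (c i - d i); rewrite combB (bigD1 i) //=.
  by rewrite big1 ?addr0 // => m mi; rewrite cd ?inE // subrr scale0r.
exists 0 => c d cd; exists 0; rewrite combB scaler0 big1 // => m _.
by rewrite cd ?inE // subrr scale0r.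
Qed.

Lemma sum_mem_set (F : {set 'I_N}) : (\sum_m (m \in F))%N = #|F|.
Proof. by rewrite -sum1_card [RHS]big_mkcond; apply: eq_bigr => m _; case: (m \in F). Qed.

(** Neighbouring tiles share at least two planes. By regularity at most 3 + 3 planes pass through
    [v] and [w], with each shared plane counted twice, which leaves at most two half crossings. *)
Lemma neighbours_sep v w : neighbours (tile v) (tile w) -> (sep v w <= 2)%N.
Proof.
case=> _ [a [b [c [[va wa] [[vb wb] [[vc wc] abc]]]]]].
have [ca vca aE] := tile_box g_unit va; have [cb vcb bE] := tile_box g_unit vb.
have [cc vcc cE] := tile_box g_unit vc; subst a b c.
have ba := shared_coords vcb vca wb wa; have ca' := shared_coords vcc vca wc wa.
have F_gt1 : (1 < #|shared v w|)%N.
  rewrite ltnNge; apply: contra abc => /comb_line[e eP].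
  have [s ->] := eP _ _ ba; have [t ->] := eP _ _ ca'.
  by rewrite crossp_colinear.
have [d wd cd] := tile_box g_unit wa.
have : (sep v w + 2 * #|shared v w| <= 6)%N; last lia.
apply: leq_trans (leq_add (card_on g_reg v) (card_on g_reg w)).
rewrite -!sum_mem_set big_distrr -!big_split leq_sum //= => m _; rewrite !inE.
have [->|vw] /= := eqVneq; first by rewrite subrr; case: (_ \is a Num.int).
rewrite muln0 addn0 (kappa_cbox (vca m)) // (comb_eq_coords vca wd cd vw); exact: wd.
Qed.

(** A chain recorded through the grid vertices of its tiles, since the vertices carry the
    coordinates. *)
Inductive walk : nat -> V -> V -> Prop :=
| walk0 v : ipoint v -> walk 0 v v
| walkS n u v w : walk n u v -> ipoint w -> neighbours (tile v) (tile w) ->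
    walk n.+1 u w.

Lemma walk_trans n1 n2 u v w : walk n1 u v -> walk n2 v w -> walk (n1 + n2) u w.
Proof.
move=> uv vw; elim: vw uv => [x _|n x y z _ IH iz yz /IH ux]; first by rewrite addn0.
by rewrite addnS; apply: walkS ux iz yz.
Qed.

Lemma walk_chain n v w (P0 : set (set V)) : ipoint v -> walk n v w -> P0 (tile v) ->
  chain_to g gamma P0 n (tile w).
Proof.
move=> iv; elim=> [x ix Px|{}n u x y _ IH iy xy /IH[s [s0 sn sT sN]]].
  by exists (fun=> tile x); split=> // m _; exists x.
exists (fun m : nat => if (m <= n)%N then s m else tile y); split=> //.
- by rewrite ltnn.
- by move=> m _; case: ifP => [/sT //|_]; exists y.
- move=> m mn1; have [->|neq] := eqVneq m n; first by rewrite leqnn ltnn sn.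
  have mn : (m < n)%N by rewrite ltn_neqAle neq -ltnS.
  by rewrite mn ltnW //; apply: sN.
Qed.

Lemma chain_sep n (s : nat -> set V) v : ipoint v -> s 0%N = tile v ->
  (forall m : nat, (m <= n)%N -> is_tile g gamma (s m)) ->
  (forall m : nat, (m < n)%N -> neighbours (s m) (s m.+1)) ->
  exists w, [/\ ipoint w, s n = tile w & (sep v w <= 2 * n)%N].
Proof.
move=> iv s0; elim: n => [|n IH] sT sN; first by exists v; rewrite sepvv.
have [m mn|m mn|w [iw sw vw]] := IH; [exact/sT/ltnW|exact/sN/ltnW|].
have [z [iz sz]] := sT n.+1 (leqnn _); exists z; split=> //.
have := sN n (ltnSn n); rewrite sw sz => /neighbours_sep wz.
by have := sep_triangle v w z; lia.
Qed.

Lemma ipoint_third v i j : ipoint v -> i != j ->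
  exists k, [/\ i != k, j != k & coord k v \is a Num.int].
Proof.
case=> [a [b [c [[ab ac bc] [/on_planeP va /on_planeP vb /on_planeP vc]]]]] ij.
have [/andP[ia ja]|] := boolP ((i != a) && (j != a)); first by exists a.
have [/andP[ib jb]|] := boolP ((i != b) && (j != b)); first by exists b.
have [/andP[ic jc]|] := boolP ((i != c) && (j != c)); first by exists c.
by rewrite !negb_and !negbK => /orP[]/eqP ic /orP[]/eqP ib /orP[]/eqP ia;
  move: ab ac bc; rewrite -?ia -?ib -?ic ?eqxx.
Qed.

Definition on_line i j v w := [/\ i != j, coord i v \is a Num.int,
  coord j v \is a Num.int, coord i w = coord i v & coord j w = coord j v].

Lemma on_line_sym i j v w : on_line i j v w -> on_line i j w v.
Proof. by case=> ij vi vj wi wj; split; rewrite // ?wi ?wj. Qed.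

Context (g_indep : forall i j k, i != j -> i != k -> j != k ->
  dotp (hvec g i j) (g k) != 0).

Lemma on_line_neq i j k v w : on_line i j v w -> v != w -> i != k -> j != k ->
  coord k v != coord k w.
Proof.
case=> ij _ _ wi wj vw ik jk; apply: contra vw => /eqP vwk.
rewrite -subr_eq0; apply/eqP/(dot3_eq0 g_indep ij ik jk);
  by rewrite -(coordB g gamma) ?wi ?wj ?vwk subrr.
Qed.

(** Each vertex lies on a third plane that misses the other vertex. Leaving the one and reaching the
    other are two half crossings, also when both planes belong to one family. *)
Lemma sep_ge2 i j v w : ipoint v -> ipoint w -> on_line i j v w -> v != w ->
  (2 <= sep v w)%N.
Proof.
move=> iv iw vw neq; have ij : i != j by case: vw.
have [k [ik jk vk]] := ipoint_third iv ij; have [l [il jl wl]] := ipoint_third iw ij.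
have hk := kappa_neq (on_line_neq vw neq ik jk); rewrite vk in hk.
have hl := kappa_neq (on_line_neq vw neq il jl); rewrite wl in hl.
rewrite /sep (bigD1 k) //=; have [lk|lk] := eqVneq l k.
  by rewrite -lk wl in hk *; apply: leq_trans hk (leq_addr _ _).
rewrite (bigD1 l) //= addnA; apply: leq_trans (leq_addr _ _).
exact: (leq_add (leq_trans (leq_addr _ 1) hk) (leq_trans (leq_addl _ 1) hl)).
Qed.

Lemma corner_sub b b' v i : coord i v \is a Num.int -> b i = false -> b' i = true ->
  (forall m, m != i -> b m = b' m) -> corner b v - corner b' v = g i.
Proof.
move=> vi bi bi' bb; rewrite combB (bigD1 i) //= bi bi' big1 ?addr0 => [|m /bb ->].
  by rewrite ceil_int // -intrB addrAC subrr add0r scale1r.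
by rewrite subrr scale0r.
Qed.

(** [floor + 1] is the first integer above the coordinate of [v], so a plane of family [m] lies
    strictly between [v] and [w], with [v] on the lower side. *)
Definition straddled v w m :=
  (coord m v < coord m w) && ((Num.floor (coord m v) + 1)%:~R < coord m w).

Context (N_gt2 : (2 < N)%N).

(** With no plane strictly between, corners on the facing sides coincide, while the sides of the
    planes [i] and [j] remain free. The common corners therefore span a parallelogram with edges
    [g i] and [g j]. *)
Lemma line_step i j v w : ipoint v -> ipoint w -> on_line i j v w -> v != w ->
  (forall m, ~~ straddled v w m && ~~ straddled w v m) -> neighbours (tile v) (tile w).
Proof.
move=> iv iw vw neq nostr; have [ij vi vj wi wj] := vw; split.
  (* The tiles differ: two corners of [tile v] on opposite sides of a third plane through [v] cannot
     both lie in [tile w]. *)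
  have [k [ik jk vk]] := ipoint_third iv ij; have neqk := on_line_neq vw neq ik jk.
  pose c b m : R := (if b m then Num.ceil (coord m v) else Num.floor (coord m v) + 1)%:~R.
  have vc b m : cbox (coord m v) (c b m).
    by rewrite /c; case: (b m); rewrite ?cbox_ceil ?cbox_floorD1.
  move=> eqT; have wc b : tile w (comb (c b)) by rewrite -eqT; apply: tile_corner.
  have := shared_coords (vc xpredT) (vc xpred0) (wc _) (wc _) (m := k).
  rewrite inE (negPf neqk) => /(_ isT); rewrite /c /= ceil_int //.
  by move/eqP; rewrite eqr_int; lia.
(* The sides facing the other vertex where the coordinates differ, and the sides given by [b] where
   they agree. *)
pose bv (b : 'I_N -> bool) m := if coord m v < coord m w then false
  else if coord m w < coord m v then true else b m.
pose bw (b : 'I_N -> bool) m := if coord m v < coord m w then true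
  else if coord m w < coord m v then false else b m.
have ceilP x y m : ~~ straddled x y m -> coord m x < coord m y ->
    Num.floor (coord m x) + 1 = Num.ceil (coord m y).
  rewrite /straddled => + xy; rewrite xy -leNgt => yx.
  have : Num.ceil (coord m y) <= Num.floor (coord m x) + 1.
    by rewrite ceil_le_int; exact: yx.
  have := floor_lt_ceil xy; lia.
have cornerE b : corner (bv b) v = corner (bw b) w.
  apply: eq_bigr => m _; rewrite /bv /bw; have /andP[nvw nwv] := nostr m.
  by case: ltgtP => [/(ceilP _ _ _ nvw) ->|/(ceilP _ _ _ nwv) ->|->].
have T b : (tile v `&` tile w) (corner (bv b) v).
  by split; [|rewrite cornerE]; apply: tile_corner.
exists (corner (bv xpredT) v), (corner (bv (predC1 i)) v), (corner (bv (predC1 j)) v).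
do 3! split=> //.
have sub l : coord l v \is a Num.int -> coord l w = coord l v ->
    corner (bv (predC1 l)) v - corner (bv xpredT) v = g l.
  by move=> vl wl; apply: corner_sub; rewrite // /bv ?wl ?ltxx /= ?eqxx // => m /negPf ->.
rewrite !sub //; exact: hvec_neq0 g_indep N_gt2 _ _ ij.
Qed.

(** The cut is made at the first plane of family [m] beyond [v], where the line has a grid vertex.
    Every coordinate is monotone along the segment, so half crossings add up. *)
Lemma line_split i j v w m : on_line i j v w -> straddled v w m ->
  exists u, [/\ ipoint u, on_line i j v u, on_line i j u w,
    (sep v u + sep u w = sep v w)%N & (0 < sep v u)%N && (0 < sep u w)%N].
Proof.
move=> [ij vi vj wi wj] /andP[vw]; set a : int := Num.floor _ + 1 => aw.
have va : coord m v < a%:~R by apply: floorD1_gt.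
pose t := (a%:~R - coord m v) / (coord m w - coord m v).
have d0 : 0 < coord m w - coord m v by rewrite subr_gt0.
have t0 : 0 <= t by rewrite divr_ge0 ?subr_ge0 ?ltW.
have t1 : t <= 1 by rewrite ler_pdivrMr // mul1r lerD2r ltW.
pose u := v + t *: (w - v).
have uE k : coord k u = coord k v + t * (coord k w - coord k v).
  by rewrite coordD dotpZl coordB.
have um : coord m u = a%:~R by rewrite uE divfK ?gt_eqF // addrC subrK.
have mi : i != m by apply: contraTneq vw => <-; rewrite wi ltxx.
have mj : j != m by apply: contraTneq vw => <-; rewrite wj ltxx.
have ui : coord i u = coord i v by rewrite uE wi subrr mulr0 addr0.
have uj : coord j u = coord j v by rewrite uE wj subrr mulr0 addr0.
exists u; split.
- exists i, j, m; split=> //; split; apply/on_planeP; rewrite ?ui ?uj //.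
  by rewrite um intr_int.
- by [].
- by split; rewrite ?ui ?uj.
- rewrite -big_split; apply: eq_bigr => k _ /=.
  have [vwk|wvk] := leP (coord k v) (coord k w).
    by apply: kappa_between; rewrite uE; nra.
  rewrite addnC distnC [X in (_ + X)%N]distnC [RHS]distnC.
  by apply: kappa_between; rewrite uE; nra.
- have uZ : coord m u \is a Num.int by rewrite um intr_int.
  have vu : coord m v != coord m u by rewrite um lt_eqF.
  have uw : coord m u != coord m w by rewrite um lt_eqF.
  have := kappa_neq vu; have := kappa_neq uw; rewrite uZ => h1 h2.
  apply/andP; split; rewrite /sep (bigD1 m) //=; apply: leq_trans (leq_addr _ _).
    exact: leq_trans (leq_addl _ 1) h2.
  exact: leq_trans (leq_addr _ 1) h1.
Qed.

Lemma line_walk i j v w : ipoint v -> ipoint w -> on_line i j v w ->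
  exists2 n, walk n v w & (2 * n <= sep v w)%N.
Proof.
(* Induction on a strict bound for [sep v w]; a split leaves two positive parts, hence two smaller
   ones. *)
move: {2}(sep v w).+1 (ltnSn (sep v w)) => b; elim: b v w => // b IH v w vwb iv iw vw.
have [->|neq] := eqVneq v w; first by exists 0%N; [exact: walk0|].
have split_at u : ipoint u -> on_line i j v u -> on_line i j u w ->
    (sep v u + sep u w = sep v w)%N -> (0 < sep v u)%N && (0 < sep u w)%N ->
    exists2 n, walk n v w & (2 * n <= sep v w)%N.
  move=> iu vu uw vuw /andP[vu0 uw0].
  have [||//|//|n1 n1w n1s] := IH v u; rewrite ?vu //; first lia.
  have [||//|//|n2 n2w n2s] := IH u w; rewrite ?uw //; first lia.
  by exists (n1 + n2)%N; [exact: walk_trans n1w n2w | lia].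
have [/existsP[m vwm]|none] := boolP [exists m, straddled v w m].
  by have [u [? ? ? ? ?]] := line_split vw vwm; apply: (split_at u).
have [/existsP[m wvm]|none'] := boolP [exists m, straddled w v m].
  have [u [iu wu uv sE /andP[? ?]]] := line_split (on_line_sym vw) wvm.
  apply: (split_at u) => //; try exact: on_line_sym.
    by rewrite !(sepC _ u) (sepC v) -sE (sepC w u) addnC.
  by rewrite !(sepC _ u) (sepC u w); apply/andP; split; rewrite // sepC.
(* No plane lies strictly between, so a single step suffices, and it is paid for by two half
   crossings. *)
exists 1%N; last exact: sep_ge2 iv iw vw neq.
apply: walkS (walk0 iv) iw (line_step iv iw vw neq _) => m.
by move: none none'; rewrite !negb_exists => /forallP -> /forallP ->.
Qed.

End Walks.

(** * The unit ball of nu and the growth polyhedron *)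

Section Polyhedron.
Context {R : realType} {N : nat} (g : 'I_N -> 'rV[R]_3).
Local Notation V := 'rV[R]_3.
Local Notation gnorm := (gnorm g).
Local Notation frame := (frame g).
Implicit Types (u v w d p q : V) (i j k l m : 'I_N) (s t : R).
Context (g_unit : forall m, vnorm (g m) = 1).
Context (g_indep : forall i j k, i != j -> i != k -> j != k ->
  dotp (hvec g i j) (g k) != 0).
Context (N_gt2 : (2 < N)%N).

Definition ray (a : 'I_N * 'I_N) : V := hvec g a.1 a.2.

(** The condition on [gnorm] makes the triangle inequality an equality, so that walking the rays in
    turn is as short as the direct way. *)
Definition ray_decomposable u := exists c : 'I_N * 'I_N -> R,
  [/\ forall a, 0 <= c a, u = \sum_a c a *: ray a & gnorm u = \sum_a c a * gnorm (ray a)].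

Lemma ray_decomposable_ray t a : 0 <= t -> ray_decomposable (t *: ray a).
Proof.
move=> t0; exists (fun b => if b == a then t else 0); split=> [b||].
- by case: ifP.
- by rewrite (bigD1 a) //= eqxx big1 ?addr0 // => b /negPf ->; rewrite scale0r.
- rewrite (bigD1 a) //= eqxx big1 ?addr0 => [|b /negPf ->]; last by rewrite mul0r.
  by rewrite gnormZ ger0_norm.
Qed.

Lemma ray_decomposable_mix s t u v : 0 <= s -> 0 <= t ->
  gnorm (s *: u + t *: v) = s * gnorm u + t * gnorm v ->
  ray_decomposable u -> ray_decomposable v -> ray_decomposable (s *: u + t *: v).
Proof.
move=> s0 t0 uvE [c [c0 uE nu]] [d [d0 vE nv]].
exists (fun a => s * c a + t * d a); split=> [a||].
- by rewrite addr_ge0 ?mulr_ge0.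
- rewrite uE vE !scaler_sumr -big_split; apply: eq_bigr => a _ /=.
  by rewrite scalerDl !scalerA.
- rewrite uvE nu nv !mulr_sumr -big_split; apply: eq_bigr => a _ /=; ring.
Qed.

Definition nonzeros u := [set m | dotp u (g m) != 0]%SET.

(* The norm is linear on the cone of the vectors whose coordinates have (weakly)
   the signs of those of [u]; [d] is tangent to the sphere inside that cone, which
   is pointed, so that moving along [d] one hits its boundary. *)
Lemma slide u d : nonzeros d \subset nonzeros u ->
  \sum_m Num.sg (dotp u (g m)) * dotp d (g m) = 0 -> d != 0 ->
  exists2 t, 0 < t & gnorm (u + t *: d) = gnorm u /\
                     nonzeros (u + t *: d) \proper nonzeros u.
Proof.
move=> /fintype.subsetP du sum0 d0.
pose a m := dotp u (g m); pose b m := Num.sg (a m) * dotp d (g m).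
have d_eq0 m : a m = 0 -> dotp d (g m) = 0.
  move=> am; apply/eqP; have := du m; rewrite !inE -/(a m) am eqxx.
  by case: (dotp d (g m) == 0) => // /(_ isT).
(* If no coordinate shrank, a vanishing sum of nonnegative terms would make every coordinate of [d]
   zero. *)
have [m0 bm0] : exists m, b m < 0.
  apply/existsP; apply: contraNT d0; rewrite negb_exists => /forallP b_ge0.
  have b0 m : 0 <= b m by rewrite leNgt.
  rewrite -(gnorm_eq0 g_indep N_gt2) psumr_eq0 => [|m _]; last exact: normr_ge0.
  move/eqP: sum0; rewrite psumr_eq0 => [/allP h|m _]; last exact: b0.
  apply/allP => m /h /=.
  rewrite mulf_eq0 sgr_eq0 normr_eq0 => /orP[/eqP/d_eq0 ->|//].
  by rewrite eqxx.
(* The time at which a shrinking coordinate reaches 0; the smallest one is used, so that no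
   coordinate has changed sign by then. *)
pose F m := `|a m| / - b m.
case: (@Order.TotalTheory.arg_minP _ _ _ m0 (fun m => b m < 0) F bm0) => m1 bm1 minF.
have a_neq0 m : b m < 0 -> a m != 0.
  by apply: contraTneq => am; rewrite /b am sgr0 mul0r ltxx.
have t0 : 0 < F m1 by rewrite divr_gt0 ?normr_gt0 ?oppr_gt0 ?a_neq0.
have sgE m : Num.sg (a m) * dotp (u + F m1 *: d) (g m) = `|a m| + F m1 * b m.
  by rewrite dotpDl dotpZl mulrDr -/(a m) normrEsg /b mulrCA.
have sg_ge0 m : 0 <= Num.sg (a m) * dotp (u + F m1 *: d) (g m).
  rewrite sgE; have [bm|bm] := leP 0 (b m).
    by rewrite addr_ge0 ?normr_ge0 // mulr_ge0 // ltW.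
  have := minF m bm; rewrite {2}/F ler_pdivlMr ?oppr_gt0 // mulrN; lra.
have normE m : `|dotp (u + F m1 *: d) (g m)| = Num.sg (a m) * dotp (u + F m1 *: d) (g m).
  have [am|am] := eqVneq (a m) 0.
    by rewrite dotpDl dotpZl -/(a m) am (d_eq0 _ am) sgr0 mul0r mulr0 addr0 normr0.
  by rewrite -[RHS]ger0_norm // normrM normr_sg am mul1r.
exists (F m1) => //; split.
  rewrite /gnorm; under eq_bigr => m _ do rewrite normE sgE.
  by rewrite big_split /= -mulr_sumr /b sum0 mulr0 addr0.
rewrite properE; apply/andP; split.
  apply/fintype.subsetP => m; rewrite !inE; apply: contraNneq => am.
  by rewrite dotpDl dotpZl am d_eq0 // mulr0 addr0.
apply/subsetPn; exists m1; rewrite !inE ?a_neq0 // negbK -normr_eq0 normE sgE.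
have -> : F m1 * b m1 = - `|a m1|.
  by rewrite /F invrN mulrN mulNr divfK // lt_eqF.
by rewrite subrr.
Qed.

Lemma ex_neq i : exists j, i != j.
Proof. by have [j /andP[ij _]] := third_index N_gt2 i i; exists j. Qed.

(** The cross product serves unless it vanishes; then [u] is a multiple of [g i], and any vector
    orthogonal to [g i] will do. *)
Lemma orth_index u i : exists2 d, d != 0 & dotp d (g i) = 0 /\ dotp d u = 0.
Proof.
have [iu|iu] := eqVneq (crossp (g i) u) 0; last first.
  by exists (crossp (g i) u) => //; rewrite dotp_crossl dotp_crossr.
have [j ij] := ex_neq i; exists (hvec g i j); first exact: hvec_neq0 g_indep N_gt2 _ _ ij.
split; first exact: dotp_crossl.
by rewrite (crossp_eq0_colinear (g_dot1 g_unit i) iu) dotpZr dotp_crossl mulr0.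
Qed.

(** Induction on the number of nonzero coordinates. Two zeros put [u] on a ray. Otherwise [u] lies
    between two vectors of the same norm, found by sliding both ways along a tangent direction, and
    each has more zeros. *)
Lemma ray_decomposition u : ray_decomposable u.
Proof.
move: {2}(#|nonzeros u|).+1 (ltnSn #|nonzeros u|) => n.
elim: n u => // n IH u un; have [->|u0] := eqVneq u 0.
  have i := Ordinal N_gt2; rewrite -(scale0r (ray (i, i))).
  exact: ray_decomposable_ray.
have [/existsP[i /existsP[j /and3P[ij /eqP ui /eqP uj]]]|zeros] :=
    boolP [exists i, exists j, [&& i != j, dotp u (g i) == 0 & dotp u (g j) == 0]].
  have [t ->] := orth2_hvec g_indep N_gt2 ij ui uj.
  have [t0|t0] := leP 0 t; first exact: (ray_decomposable_ray (i, j)).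
  rewrite hvecC scalerN -scaleNr; apply: (ray_decomposable_ray (j, i)).
  by rewrite oppr_ge0 ltW.
(* [i] is the only possible zero coordinate; it is arbitrary if there is none. *)
have [i iP] : exists i, forall m, dotp u (g m) = 0 -> m = i.
  have [/existsP[i /eqP ui]|none] := boolP [exists i, dotp u (g i) == 0].
    exists i => m um; apply/eqP; apply: contraNT zeros => mi.
    by apply/existsP; exists m; apply/existsP; exists i; rewrite mi um ui eqxx.
  exists (Ordinal N_gt2) => m um; case/negP: none.
  by apply/existsP; exists m; rewrite um.
(* The linear form that gives nu on the cone of [u]; a direction orthogonal to it keeps nu constant
   there. *)
pose f := \sum_m Num.sg (dotp u (g m)) *: g m.
have [d d0 [di df]] := orth_index f i.
have sub : nonzeros d \subset nonzeros u.
  by apply/fintype.subsetP => m; rewrite !inE; apply: contraNneq => /iP ->; rewrite di.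
have sum0 : \sum_m Num.sg (dotp u (g m)) * dotp d (g m) = 0.
  by rewrite -[RHS]df dotp_sumr; apply: eq_bigr => m _; rewrite dotpZr.
have [s s0 [us /proper_card uns]] := slide sub sum0 d0.
have subN : nonzeros (- d) \subset nonzeros u.
  by apply: fintype.subset_trans sub; apply/fintype.subsetP => m; rewrite !inE dotpNl oppr_eq0.
have sumN0 : \sum_m Num.sg (dotp u (g m)) * dotp (- d) (g m) = 0.
  under eq_bigr => m _ do rewrite dotpNl mulrN.
  by rewrite sumrN sum0 oppr0.
have dN0 : - d != 0 by rewrite oppr_eq0.
have [t t0 [ut /proper_card unt]] := slide subN sumN0 dN0.
have st0 : s + t != 0 by rewrite gt_eqF ?addr_gt0.
have uE : u = (t / (s + t)) *: (u + s *: d) + (s / (s + t)) *: (u + t *: - d).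
  apply/rowP => a; rewrite !mxE; field; exact: st0.
rewrite {1}uE; apply: ray_decomposable_mix.
- by rewrite divr_ge0 ?addr_ge0 // ltW.
- by rewrite divr_ge0 ?addr_ge0 // ltW.
- by rewrite -uE us ut -mulrDl -mulrDl (addrC t) divff // mul1r.
- by apply: IH; apply: leq_trans uns _.
- by apply: IH; apply: leq_trans unt _.
Qed.

Lemma conv_fin (I : finType) (A : set V) (p : I -> V) (l : I -> R) :
  (forall a, A (p a)) -> (forall a, 0 <= l a) -> \sum_a l a = 1 ->
  conv A (\sum_a l a *: p a).
Proof.
move=> Ap l_ge0 l1; exists #|I|, (p \o enum_val), (l \o enum_val).
split=> [a|]; first exact: Ap.
split=> [a|]; first exact: l_ge0.
rewrite -l1; split; first by rewrite (reindex (@enum_val I I)) //; apply/onW_bij/enum_val_bij.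
by rewrite (reindex (@enum_val I I)) //; apply/onW_bij/enum_val_bij.
Qed.

(** Here [1 / delta] is the absolute value of the scalar product of [h] and [g k], divided by the
    length of [h], and [eps] restores the sign. The length cancels in the quotient, and the families
    [i] and [j] contribute 0. *)
Lemma growth_vertexE i j : i != j ->
  (Delta g i j)^-1 *: upsilon g i j = (gnorm (hvec g i j))^-1 *: frame (hvec g i j).
Proof.
move=> ij; set h := hvec g i j.
have h0 : h != 0 := hvec_neq0 g_indep N_gt2 ij.
have zero m : ~~ ((m != i) && (m != j)) -> dotp h (g m) = 0.
  by rewrite negb_and !negbK => hm; apply/eqP; rewrite (dotp_hvec_eq0 g_indep).
have -> : Delta g i j = (vnorm h)^-1 * gnorm h.
  rewrite /gnorm mulr_sumr /Delta big_mkcond; apply: eq_bigr => m _.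
  by case: ifPn => [_|/zero ->]; rewrite ?normr0 ?mulr0 // invf_div mulrC.
have -> : upsilon g i j = (vnorm h)^-1 *: frame h.
  rewrite /frame scaler_sumr /upsilon big_mkcond; apply: eq_bigr => m _.
  case: ifPn => [_|/zero ->]; last by rewrite scale0r scaler0.
  rewrite scalerA /delta /eps /Ddet det_rows3 -/(hvec g i j) -/h invf_div.
  congr (_ *: _); rewrite mulrA mulrC; congr (_ * _).
  case: ltrP => [lt|le]; first by rewrite mul1r gtr0_norm.
  by rewrite mulN1r ler0_norm // opprK.
rewrite scalerA invfM invrK mulrAC mulfV ?mul1r // vnorm_eq0 //.
Qed.

Lemma growth_vertex_ray i j : i != j ->
  growth_vertices g ((gnorm (hvec g i j))^-1 *: frame (hvec g i j)).
Proof.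
move=> ij; case: (ltngtP i j) => [lt|gt|/val_inj eq]; last by rewrite eq eqxx in ij.
  by exists i, j; split=> //; left; rewrite growth_vertexE.
exists j, i; split=> //; right; rewrite growth_vertexE 1?eq_sym //.
by rewrite (hvecC g i) gnormN -scaleN1r frameZ scaleN1r scalerN.
Qed.

(** The image of the unit ball under M is convex and contains the vertices. *)
Lemma conv_growth_vertices p : conv (growth_vertices g) p ->
  exists2 u, gnorm u <= 1 & p = frame u.
Proof.
have vertex q : growth_vertices g q -> exists u, gnorm u <= 1 /\ q = frame u.
  move=> [i [j [ij]]]; have {}ij : i != j by rewrite -(inj_eq val_inj) ltn_eqF.
  have h0 : gnorm (hvec g i j) != 0.
    by rewrite (gnorm_eq0 g_indep N_gt2) (hvec_neq0 g_indep).
  rewrite growth_vertexE // -frameZ.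
  set u := _ *: hvec g i j; have u1 : gnorm u <= 1.
    by rewrite gnormZ ger0_norm ?invr_ge0 ?gnorm_ge0 // mulVf.
  case=> ->; first by exists u.
  by exists (-1 *: u); rewrite gnormZ normrN1 mul1r [frame (-1 *: _)]frameZ scaleN1r.
move=> [n [q [l [qv [l_ge0 [l1 ->]]]]]].
have /fin_all_exists[u uP] a : exists u, gnorm u <= 1 /\ q a = frame u by apply: vertex.
exists (\sum_a l a *: u a).
  apply: le_trans (gnorm_sum _ _) _; rewrite -l1; apply: ler_sum => a _.
  by have [ua _] := uP a; rewrite gnormZ ger0_norm // ler_piMr.
by rewrite frame_sum; apply: eq_bigr => a _; rewrite frameZ; have [_ ->] := uP a.
Qed.

Lemma frame_conv u : gnorm u = 1 -> conv (growth_vertices g) (frame u).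
Proof.
move=> u1; have [c [c_ge0 uE nE]] := ray_decomposition u.
have [j ij] := ex_neq (Ordinal N_gt2).
(* A hull point needs a vertex for every index; the diagonal pairs have a zero ray and weight 0, and
   take this default. *)
pose dflt := (gnorm (hvec g (Ordinal N_gt2) j))^-1 *: frame (hvec g (Ordinal N_gt2) j).
pose p (a : 'I_N * 'I_N) := if a.1 == a.2 then dflt
  else (gnorm (ray a))^-1 *: frame (ray a).
have -> : frame u = \sum_a (c a * gnorm (ray a)) *: p a.
  rewrite uE frame_sum; apply: eq_bigr => -[i k] _; rewrite /p /=.
  have [ik|ik] := eqVneq i k.
    by rewrite /ray /= ik hvecii scaler0 gnorm0 mulr0 scale0r frame0.
  rewrite frameZ scalerA mulfK // (gnorm_eq0 g_indep N_gt2).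
  exact: hvec_neq0 g_indep N_gt2 _ _ ik.
apply: conv_fin => [[i k]|a|]; last by rewrite -nE.
  by rewrite /p /=; have [_|ik] := eqVneq i k; apply: growth_vertex_ray.
by rewrite mulr_ge0 ?gnorm_ge0.
Qed.

Lemma growth_polyhedron_sphere u : gnorm u = 1 -> growth_polyhedron g (frame u).
Proof.
move=> u1 r r0; split.
  by exists (frame u); rewrite subrr vnorm0; split=> //; apply: frame_conv.
pose e := r / 2; have e0 : 0 < e by rewrite divr_gt0.
(* A slightly longer vector lies outside the unit ball, and injectivity of M puts its image outside
   the hull. *)
exists (frame ((1 + e) *: u)); split.
  case/conv_growth_vertices => v v1 /(frame_inj g_indep N_gt2) uv.
  by move: v1; rewrite -uv gnormZ u1 mulr1 gtr0_norm ?addr_gt0 //; lra.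
rewrite frameZ scalerDl scale1r addrAC subrr add0r vnormZ gtr0_norm //.
have := vnorm_frame g_unit u; rewrite u1 /e; nra.
Qed.

End Polyhedron.

(** * Walks between arbitrary grid vertices *)

Section Travel.
Context {R : realType} {N : nat} (g : 'I_N -> 'rV[R]_3) (gamma : 'I_N -> R).
Local Notation V := 'rV[R]_3.
Local Notation coord := (coord g gamma).
Local Notation gnorm := (gnorm g).
Local Notation ray := (ray g).
Local Notation ipoint := (ipoint g gamma).
Local Notation walk := (walk g gamma).
Local Notation on_line := (on_line g gamma).
Implicit Types (u v w x y z : V) (i j k l m : 'I_N) (s t c d : R).
Context (g_unit : forall m, vnorm (g m) = 1).
Context (g_indep : forall i j k, i != j -> i != k -> j != k ->
  dotp (hvec g i j) (g k) != 0).
Context (g_reg : regular_grid g gamma).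
Context (N_gt2 : (2 < N)%N).

Definition reach v w c := exists2 n, walk n v w & n%:R <= c.

Lemma reach_refl v : ipoint v -> reach v v 0.
Proof. by exists 0%N => //; apply: walk0. Qed.

Lemma reach_trans v w z c d : reach v w c -> reach w z d -> reach v z (c + d).
Proof.
move=> [n vw nc] [n' wz nd]; exists (n + n')%N; first exact: walk_trans vw wz.
by rewrite natrD lerD.
Qed.

Lemma reach_le v w c d : reach v w c -> c <= d -> reach v w d.
Proof. by move=> [n vw nc] cd; exists n => //; apply: le_trans nc cd. Qed.

Lemma reach_line i j v w : ipoint v -> ipoint w -> on_line i j v w ->
  reach v w (gnorm (v - w) + N%:R).
Proof.
move=> iv iw vw.
have [n nw ns] := line_walk g_unit g_reg g_indep N_gt2 iv iw vw; exists n => //.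
have := sep_gnorm g gamma v w; rewrite ler_norml => /andP[_ h].
have : (2 * n)%:R <= (sep g gamma v w)%:R :> R by rewrite ler_nat.
rewrite natrM; lra.
Qed.

(** The plane chosen depends only on [x] and [m], so vertices rounded from the same [x] in two
    common families lie on one grid line. *)
Definition ceil_on x v m := coord m v = (Num.ceil (coord m x))%:~R.

Lemma near_ipoint : exists2 C, 0 <= C & forall x i j k,
  i != j -> i != k -> j != k -> exists v,
  [/\ ipoint v, gnorm (v - x) <= C, ceil_on x v i, ceil_on x v j & ceil_on x v k].
Proof.
(* Rounding up moves each of the three coordinates by at most 1, hence [A * 3]. *)
have [A A0 AP] := gnorm_le_triple g_indep; exists (A * 3); first by rewrite mulr_ge0.
move=> x i j k ij ik jk.
pose r m := (Num.ceil (coord m x))%:~R - coord m x.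
have [u [ui uj uk]] := dot3_solve g_indep r ij ik jk.
have vm m : dotp u (g m) = r m -> ceil_on x (x + u) m.
  by rewrite /ceil_on coordD => ->; rewrite addrC subrK.
have r1 m : `|r m| <= 1 by apply/cbox_near/cbox_ceil.
exists (x + u); split; try exact: vm.
  exists i, j, k; split=> //; split; apply/on_planeP; rewrite (vm, vm) ?intr_int //;
    by rewrite vm ?intr_int.
rewrite addrAC subrr add0r (le_trans (AP i j k u ij ik jk)) // ler_wpM2l //.
rewrite ui uj uk; have := r1 i; have := r1 j; have := r1 k; lra.
Qed.

Section Near.
Context (C : R) (C_ge0 : 0 <= C) (near_ex : forall x i j k,
  i != j -> i != k -> j != k -> exists v,
  [/\ ipoint v, gnorm (v - x) <= C, ceil_on x v i, ceil_on x v j & ceil_on x v k]).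

Local Notation K := (C + C + N%:R).

Definition near x i j v :=
  [/\ i != j, ipoint v, gnorm (v - x) <= C, ceil_on x v i & ceil_on x v j].

Lemma near_sym x i j v : near x i j v -> near x j i v.
Proof. by case=> ij iv vx vi vj; split; rewrite // eq_sym. Qed.

Lemma K_ge0 : 0 <= K.
Proof. by rewrite !addr_ge0. Qed.

Lemma near_line x i j v w : near x i j v -> near x i j w -> reach v w K.
Proof.
move=> [ij iv vx vi vj] [_ iw wx wi wj].
have vw : on_line i j v w by split; rewrite ?vi ?vj ?wi ?wj ?intr_int.
apply: reach_le (reach_line iv iw vw) _; rewrite lerD2r.
by apply: le_trans (gnorm_dist g v x w) _; rewrite lerD // gnormB.
Qed.

Lemma near_swap x i j k v : near x i j v -> i != k -> j != k ->
  exists2 w, near x i k w & reach v w K.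
Proof.
move=> vx ik jk; have ij : i != j by case: vx.
have [w [iw wx wi wj wk]] := near_ex x ij ik jk.
by exists w; [split | apply: near_line vx _; split].
Qed.

Lemma near_turn1 x i j l v : near x i j v -> exists m w, near x l m w /\ reach v w K.
Proof.
move=> vx; have vv : reach v v K.
  by case: vx => _ iv _ _ _; apply: reach_le (reach_refl iv) K_ge0.
have [<-|il] := eqVneq i l; first by exists j, v.
have [<-|jl] := eqVneq j l; first by exists i, v; split=> //; apply: near_sym.
by have [w wx vw] := near_swap vx il jl; exists i, w; split=> //; apply: near_sym.
Qed.

(** The line is turned by exchanging one of its two planes at a time; two exchanges suffice. *)
Lemma near_turn x i j l m v : near x i j v -> l != m ->
  exists2 w, near x l m w & reach v w (K + K).
Proof.
move=> /(near_turn1 l)[a [w [wx vw]]] lm; have [am|am] := eqVneq a m.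
  by subst a; exists w => //; apply: reach_le vw _; rewrite lerDl K_ge0.
by have [z zx wz] := near_swap wx lm am; exists z => //; apply: reach_trans vw wz.
Qed.

(** After a turn onto the planes [l] and [m] the ray is parallel to the grid line, and the rounding
    in these two families does not change along it. The third [K] pays for the offsets at both ends
    and the error of the line walk. *)
Lemma near_ray x i j v a c : near x i j v -> 0 <= c -> exists l m w,
  near (x + c *: ray a) l m w /\ reach v w (c * gnorm (ray a) + (K + K + K)).
Proof.
case: a => l m vx c0; have [<-|lm] := eqVneq l m.
  exists i, j, v; rewrite /ray hvecii scaler0 addr0 gnorm0 mulr0 add0r; split=> //.
  case: vx => _ iv _ _ _; apply: reach_le (reach_refl iv) _.
  by have := K_ge0; lra.
have [w [_ iw wx wl wm] vw] := near_turn vx lm; have [k /andP[lk mk]] := third_index N_gt2 l m.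
have [z [iz zx zl zm _]] := near_ex (x + c *: ray (l, m)) lm lk mk.
have coordl : coord l (x + c *: ray (l, m)) = coord l x.
  by rewrite coordD dotpZl dotp_crossl mulr0 addr0.
have coordm : coord m (x + c *: ray (l, m)) = coord m x.
  by rewrite coordD dotpZl dotp_crossr mulr0 addr0.
exists l, m, z; split; first by split.
have wz : on_line l m w z.
  by rewrite /ceil_on coordl in zl; rewrite /ceil_on coordm in zm;
     split; rewrite ?wl ?wm ?zl ?zm ?intr_int.
apply: reach_le (reach_trans vw (reach_line iw iz wz)) _.
set x' := x + _ in zx *; have xx' : gnorm (x - x') = c * gnorm (ray (l, m)).
  by rewrite gnormB addrAC subrr add0r gnormZ ger0_norm.
have := gnorm_dist g w x z; have := gnorm_dist g x x' z; rewrite xx' (gnormB g x' z); lra.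
Qed.

Lemma near_rays (c : 'I_N * 'I_N -> R) (r : seq ('I_N * 'I_N)) x i j v :
  (forall a, 0 <= c a) -> near x i j v -> exists l m w,
  near (x + \sum_(a <- r) c a *: ray a) l m w /\
  reach v w (\sum_(a <- r) (c a * gnorm (ray a) + (K + K + K))).
Proof.
move=> c0; elim: r x i j v => [|a r IH] x i j v vx.
  exists i, j, v; rewrite !big_nil addr0; split=> //.
  by case: vx => _ iv _ _ _; apply: reach_refl.
have [l [m [w [wx vw]]]] := near_ray a vx (c0 a).
have [l' [m' [w' [wx' vw']]]] := IH _ _ _ _ wx.
exists l', m', w'; rewrite !big_cons addrA; split=> //.
exact: reach_trans vw vw'.
Qed.

Lemma near_self v : ipoint v -> exists i j, near v i j v.
Proof.
move=> iv; case: (iv) => i [j [_ [[ij _ _] [/on_planeP vi /on_planeP vj _]]]].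
by exists i, j; split; rewrite // ?subrr ?gnorm0 // /ceil_on ceil_int // floorK.
Qed.

(** The rays composing [z - v] are walked in turn; the last [K + K + K] pays for the turn onto a
    grid line through [z] and the walk along it. *)
Lemma reach_far v z : ipoint v -> ipoint z ->
  reach v z (gnorm (z - v) + (\sum_(a : 'I_N * 'I_N) (K + K + K) + (K + K + K))).
Proof.
move=> iv iz; have [c [c0 zvE zvN]] := ray_decomposition g_unit g_indep N_gt2 (z - v).
have [i [j vv]] := near_self iv; have [i' [j' zz]] := near_self iz.
have [l [m [w [wx vw]]]] := near_rays (index_enum _) c0 vv.
rewrite -zvE addrC subrK in wx; have ij' : i' != j' by case: zz.
have [w' wz' ww'] := near_turn wx ij'.
have wz := near_line wz' zz.
apply: reach_le (reach_trans vw (reach_trans ww' wz)) _.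
by rewrite big_split /= -zvN; lra.
Qed.

End Near.

Lemma walk_length_bound : exists B, forall v z, ipoint v -> ipoint z ->
  reach v z (gnorm (z - v) + B).
Proof.
have [C C0 near_ex] := near_ipoint.
by exists (\sum_(a : 'I_N * 'I_N) (C + C + N%:R + (C + C + N%:R) + (C + C + N%:R)) +
  (C + C + N%:R + (C + C + N%:R) + (C + C + N%:R))) => v z iv iz; apply: reach_far.
Qed.

End Travel.

(** * From walk lengths to the growth form *)

Lemma finite_set_nat_bound (T : pointedType) (A : set T) (Q : T -> nat -> Prop) :
  finite_set A -> (forall a m n, (m <= n)%N -> Q a m -> Q a n) ->
  (forall a, A a -> exists n, Q a n) -> exists n, forall a, A a -> Q a n.
Proof.
move=> /finite_set_leP[n /pcard_surjP[f fA]] Qmono QA.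
have /fin_all_exists[b bP] (k : 'I_n) : exists b, A (f k) -> Q (f k) b.
  have [/QA[b Qb]|nA] := pselect (A (f k)); first by exists b.
  by exists 0%N.
exists (\sum_k b k)%N => a Aa; have [k kn fk] := fA a Aa; move: Aa; rewrite -fk.
move=> /(bP (Ordinal kn)); apply: Qmono.
by rewrite (bigD1 (Ordinal kn)) //= leq_addr.
Qed.

Theorem theorem4 (R : realType) (N : nat) (g : 'I_N -> 'rV[R]_3) (gamma : 'I_N -> R) :
  (forall i, vnorm (g i) = 1) ->
  (forall i j k : 'I_N, i != j -> i != k -> j != k ->
     row_free (rows3 (g i) (g j) (g k))) ->
  regular_grid g gamma ->
  growth_form g gamma (growth_polyhedron g).
Proof.
move=> g_unit g_free g_reg P0 P0fin [p0 P0p0] P0tile.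
have g_indep i j k : i != j -> i != k -> j != k -> dotp (hvec g i j) (g k) != 0.
  move=> ij ik jk; rewrite -det_rows3 -unitfE -unitmxE -row_free_unit.
  exact: g_free.
have [y0 [iy0 p0E]] := P0tile _ P0p0.
(* [P0] contains a tile, whose vertex lies on planes of three families. *)
have N_gt2 : (2 < N)%N.
  have [i [j [k [[ij ik jk] _]]]] := iy0.
  have := max_card [set i; j; k]%SET.
  by rewrite card_ord -finset.setUA !cardsU1 cards1 !inE negb_or ij ik jk.
have [B reachB] := walk_length_bound g_unit g_indep g_reg N_gt2.
have [D DP] : exists D, forall p, P0 p ->
    exists x, [/\ ipoint g gamma x, p = tile g gamma x & (sep g gamma y0 x <= D)%N].
  apply: finite_set_nat_bound P0fin _ _ => [p m n mn [x [ix px xm]]|p /P0tile[x [ix px]]].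
    by exists x; split=> //; apply: leq_trans xm mn.
  by exists (sep g gamma y0 x), x.
(* The centre is the combination of the normals with the coordinates of [y0]. The constant allows
   [N] for the position inside a tile and [B + D + N] for the error of the radius. *)
exists (frame g y0 - comb g gamma), (N%:R + (B + D%:R + N%:R)) => n t.
move=> [_ [[s [Ps0 snt sT sN]] tmin]] p tp.
have [x [ix s0E xD]] := DP _ Ps0.
have [w [iw swE xw]] := chain_sep g_unit g_reg ix s0E sT sN.
have tE : t = tile g gamma w by rewrite -snt.
have upper : gnorm g (w - y0) <= n%:R + D%:R + N%:R.
  have : (sep g gamma y0 w <= 2 * n + D)%N.
    by apply: leq_trans (sep_triangle g gamma y0 x w) _; rewrite addnC leq_add.
  rewrite -(ler_nat R) natrD natrM.
  have := sep_gnorm g gamma y0 w; rewrite gnormB ler_norml => /andP[h _].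
  have := ler0n R D; lra.
(* A shorter walk from [y0] would be a chain from [P0] of length less than [n], which the shell
   excludes. *)
have lower : n%:R <= gnorm g (w - y0) + B.
  have [n' walkn' n'B] := reachB _ _ iy0 iw; apply: le_trans n'B; rewrite ler_nat leqNgt.
  apply/negP => /tmin; apply; rewrite tE.
  by apply: walk_chain iy0 walkn' _; rewrite -p0E.
have B_ge0 : 0 <= B.
  by have [m _ mB] := reachB _ _ iy0 iy0; rewrite subrr gnorm0 add0r in mB;
     apply: le_trans (ler0n R m) mB.
(* If [w = y0], any vector of norm 1 serves as the direction. *)
have [e e1 we] : exists2 e, gnorm g e = 1 & w - y0 = gnorm g (w - y0) *: e.
  have unit u : u != 0 -> gnorm g ((gnorm g u)^-1 *: u) = 1.
    rewrite -(gnorm_eq0 g_indep N_gt2) => u0.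
    by rewrite gnormZ ger0_norm ?invr_ge0 ?gnorm_ge0 // mulVf.
  have [->|w0] := eqVneq (w - y0) 0.
    have [j ij] := ex_neq N_gt2 (Ordinal N_gt2).
    exists ((gnorm g (hvec g (Ordinal N_gt2) j))^-1 *: hvec g (Ordinal N_gt2) j).
      exact/unit/(hvec_neq0 g_indep).
    by rewrite gnorm0 scale0r.
  exists ((gnorm g (w - y0))^-1 *: (w - y0)); first exact: unit.
  by rewrite scalerA divff ?scale1r // (gnorm_eq0 g_indep N_gt2).
exists (frame g y0 - comb g gamma + n%:R *: frame g e); split.
  by exists (frame g e) => //; apply: growth_polyhedron_sphere.
have [c cw ->] := tile_box g_unit (eq_ind _ (fun T => T p) tp _ tE).
(* The error splits into the deviation inside the tile, at most 1 per family, and the radial error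
   [gnorm (w - y0) - n]. *)
have -> : comb g c - (frame g y0 - comb g gamma + n%:R *: frame g e) =
    (comb g c - comb g (fun m => coord g gamma m w)) + (gnorm g (w - y0) - n%:R) *: frame g e.
  have -> : comb g (fun m => coord g gamma m w) = frame g w - comb g gamma by rewrite combB.
  have weE : gnorm g (w - y0) *: frame g e = frame g w - frame g y0.
    by rewrite -frameZ -we frameB.
  rewrite scalerBl weE.
  by apply/rowP => a; rewrite !mxE; ring.
apply: le_trans (vnormD _ _) _; apply: lerD.
  rewrite combB; apply: le_trans (vnorm_comb g_unit _) _.
  have -> : N%:R = \sum_(m < N) 1 :> R by rewrite sumr_const card_ord.
  by apply: ler_sum => m _; apply: cbox_near.
rewrite vnormZ; apply: le_trans (ler_wpM2l (normr_ge0 _) (vnorm_frame g_unit _)) _.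
rewrite e1 mulr1 ler_norml; have := ler0n R D; have := ler0n R N.
by move=> ? ?; apply/andP; split; lra.
Qed.
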